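(* Let $G$ be a quadrangulation graph with $n\geq 4$ vertices. Then \[ W(G)\leq \begin{cases} \frac{1}{12}n^3+\frac{7}{6}n-2, & \text{if } n\equiv 0 \pmod 2,\\[2pt] \frac{1}{12}n^3+\frac{11}{12}n-1, & \text{if } n\equiv 1 \pmod 2. \end{cases} \]
   Context: All graphs are finite, simple and connected. A quadrangulation graph is a simple plane graph (a planar graph together with a fixed embedding in the plane) in which every face, including the unbounded one, is bounded by a cycle of length 4. For a connected graph $G$, $d_G(u,v)$ denotes the length of a shortest path between $u$ and $v$, and the Wiener index is $W(G)=\sum_{\{u,v\}\subseteq V(G)} d_G(u,v)$, the sum over all unordered pairs of distinct vertices. *)

(* Defs.v *)
From HB Require Import structures.
From mathcomp Require Import all_boot all_order all_algebra.
Set Implicit Arguments. Unset Strict Implicit. Unset Printing Implicit Defensive.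
Import Order.TTheory GRing.Theory Num.Theory.

Definition simple_graph (V : finType) (e : rel V) : Prop :=
  symmetric e /\ irreflexive e.

Definition connected_graph (V : finType) (e : rel V) : Prop :=
  forall u v, connect e u v.

(* Combinatorial embedding (rotation system): for each vertex u, rot u
   restricted to the neighbourhood of u is a cyclic permutation of it. *)
Definition rotation_system (V : finType) (e : rel V) (rot : V -> V -> V) : Prop :=
  forall u : V,
    [/\ {in e u, forall v, e u (rot u v)},
        {in e u &, injective (rot u)} &
        {in e u &, forall v w, fconnect (rot u) v w}].

Definition darts (V : finType) (e : rel V) : {set V * V} :=
  [set p : V * V | e p.1 p.2].

Definition face_succ (V : finType) (rot : V -> V -> V) (p : V * V) : V * V :=
  (p.2, rot p.2 p.1).

Definition face_of (V : finType) (rot : V -> V -> V) (p : V * V) : {set V * V} :=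
  [set q | fconnect (face_succ rot) p q].

Definition nfaces (V : finType) (e : rel V) (rot : V -> V -> V) : nat :=
  #|[set face_of rot p | p in darts e]|.

(* Euler's formula V - E + F = 2 (genus 0, i.e. the embedding is planar);
   stated with #darts = 2 #E. *)
Definition spherical (V : finType) (e : rel V) (rot : V -> V -> V) : Prop :=
  2 * (#|V| + nfaces e rot) = #|darts e| + 4.

Definition faces_are_4cycles (V : finType) (e : rel V) (rot : V -> V -> V) : Prop :=
  forall p, p \in darts e ->
    iter 4 (face_succ rot) p = p /\
    uniq [seq (iter i (face_succ rot) p).1 | i <- iota 0 4].

Definition quadrangulation (V : finType) (e : rel V) (rot : V -> V -> V) : Prop :=
  [/\ simple_graph e, connected_graph e, rotation_system e rot,
      spherical e rot & faces_are_4cycles e rot].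

Definition walk_of_length (V : finType) (e : rel V) (k : nat) (u v : V) : bool :=
  [exists p : k.-tuple V, path e u p && (last u p == v)].

(* graph distance: least k with a u-v walk of length k
   (for connected graphs this is < #|V|) *)
Definition dist (V : finType) (e : rel V) (u v : V) : nat :=
  find (fun k => walk_of_length e k u v) (iota 0 #|V|).

Definition wiener (V : finType) (e : rel V) : nat :=
  \sum_(i < #|V|) \sum_(j < #|V| | i < j) dist e (enum_val i) (enum_val j).

(* Main.v *)
(** Call a vertex set [S] sparse if every [T] in it with at least three vertices spans at
    most [2|T| - 4] edges, and tight if moreover [S] itself spans exactly [2|S| - 4].
    Deleting the vertices outside [T] one at a time shows that Euler's inequality passes
    to induced subgraphs, and every region cut out by [T] has an Eulerian boundary, so a
    quadrangulation is triangle-free, sparse and tight.  The bound then holds for all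
    triangle-free tight sets [S], by induction on [n = |S|].  Counting edges across a
    separation shows that a tight graph with at least four vertices is 2-connected and
    that both sides of a 2-separation are again tight; hence the spheres around a vertex
    have at least two points each.
    - If some vertex has degree 2, delete it: its transmission is at most the increment
      of the bound.  For odd [n] there is one exception, a vertex whose first two spheres
      both have two points, and then a neighbour of it is deleted as well.
    - If all degrees are at least 3 and there is no 2-separation, all spheres have at
      least three points, and summing over the [2n - 4] edges gives the bound.
    - Otherwise take a 2-separation [(P, L, Q)] with [|P|] minimal and apply induction to
      both sides.  By minimality the spheres around [L] in [P] have at least three
      points, which makes the distances between [P] and [Q] small enough. *)

Require Import Defs.
From HB Require Import structures.
From mathcomp Require Import all_boot all_order all_algebra.
From mathcomp Require Import zify lra.
Set Implicit Arguments. Unset Strict Implicit. Unset Printing Implicit Defensive.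

(** * Distances inside induced subgraphs *)

Section Balls.

Variables (V : finType) (e : rel V).
Hypotheses (eC : symmetric e) (eI : irreflexive e).
Implicit Types (S X T P L Q : {set V}) (u v w x y : V).

Definition nbhd S X : {set V} := [set v in S | [exists u in X, e u v]].

Fixpoint ball S X k : {set V} :=
  if k is k'.+1 then ball S X k' :|: nbhd S (ball S X k') else X.

(* The distance from [X] to [v] in the subgraph induced by [S]; it is [#|V|]
   when [v] is not reachable. *)
Definition sdist S X v : nat := \sum_(k < #|V|) (v \notin ball S X k).

Lemma in_nbhd S X v u : v \in S -> u \in X -> e u v -> v \in nbhd S X.
Proof. by move=> vS uX uv; rewrite inE vS; apply/existsP; exists u; rewrite uX. Qed.

Lemma nbhdP S X v :
  reflect (v \in S /\ exists2 u, u \in X & e u v) (v \in nbhd S X).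
Proof.
rewrite inE; apply: (iffP andP) => [[vS /existsP[u /andP[uX uv]]]|[vS [u uX uv]]].
  by split=> //; exists u.
by split=> //; apply/existsP; exists u; rewrite uX.
Qed.

Lemma nbhd_mono S S' X X' : S \subset S' -> X \subset X' ->
  nbhd S X \subset nbhd S' X'.
Proof.
move=> /subsetP sS /subsetP sX; apply/subsetP=> v /nbhdP[vS [u uX uv]].
by apply/nbhdP; split; [exact: sS | exists u; rewrite ?sX].
Qed.

Lemma ball_mono S S' X X' k : S \subset S' -> X \subset X' ->
  ball S X k \subset ball S' X' k.
Proof. by move=> sS sX; elim: k => //= k IH; apply: setUSS => //; apply: nbhd_mono. Qed.

Lemma ball_sub S X k : X \subset S -> ball S X k \subset S.
Proof.
move=> XS; elim: k => //= k IH; rewrite subUset IH /=.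
by apply/subsetP=> v /nbhdP[].
Qed.

Lemma ball_le S X j k : j <= k -> ball S X j \subset ball S X k.
Proof.
elim: k => [|k IH]; first by rewrite leqn0 => /eqP->.
rewrite leq_eqVlt => /orP[/eqP->//|]; rewrite ltnS => /IH h.
by apply: subset_trans h _; apply: subsetUl.
Qed.

Lemma ball_add S X j k : ball S X (j + k) = ball S (ball S X j) k.
Proof. by elim: k => [|k IH]; rewrite ?addn0 // addnS /= IH. Qed.

Lemma ball_step S X k u v : u \in ball S X k -> v \in S -> e u v ->
  v \in ball S X k.+1.
Proof. by move=> uB vS uv; rewrite /= inE (in_nbhd vS uB uv) orbT. Qed.

Lemma ball_singleW S X k v : v \in ball S X k ->
  exists2 u, u \in X & v \in ball S [set u] k.
Proof.
elim: k v => [|k IH] v /=; first by exists v => //; rewrite inE.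
rewrite inE => /orP[/IH[u uX h]|/nbhdP[vS [w /IH[u uX h] wv]]].
  by exists u => //; rewrite inE h.
by exists u => //; apply: ball_step h vS wv.
Qed.

Lemma ball_sym S u v k : u \in S -> v \in ball S [set u] k -> u \in ball S [set v] k.
Proof.
move=> uS; elim: k v => [|k IH] v /=; first by rewrite !inE eq_sym.
rewrite inE => /orP[/IH h|/nbhdP[vS [w wB wv]]]; first by rewrite inE h.
suff : u \in ball S [set v] (1 + k) by [].
rewrite ball_add; apply: (subsetP (ball_mono _ (subxx _) _)) (IH _ wB).
rewrite sub1set; apply: (ball_step (u := v)); rewrite ?inE ?eqxx // 1?eC //.
by apply: subsetP wB; apply: ball_sub; rewrite sub1set.
Qed.

Lemma sdist_le_card S X v : sdist S X v <= #|V|.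
Proof.
rewrite -[X in _ <= X]card_ord -sum1_card; apply: leq_sum => k _; exact: leq_b1.
Qed.

Lemma sdist_le S X v k : v \in ball S X k -> sdist S X v <= k.
Proof.
move=> vk; have [kN|/ltnW Nk] := leqP k #|V|; last first.
  exact: leq_trans (sdist_le_card _ _ _) Nk.
rewrite /sdist -(big_mkord xpredT (fun k => (v \notin ball S X k) : nat)).
rewrite (big_cat_nat (n := k)) //= [X in _ + X]big1_seq ?addn0.
  rewrite -[X in _ <= X]subn0 -[X in _ <= X]muln1 -sum_nat_const_nat.
  by apply: leq_sum => j _; apply: leq_b1.
move=> j; rewrite mem_index_iota => /andP[_ /andP[kj _]].
by rewrite (subsetP (ball_le _ _ kj)).
Qed.

(** The least [m] with [v] in the [m]-th ball equals the sum: every radius below [m] contributes 1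
    and none from [m] on does. *)
Lemma sdist_ball S X v : sdist S X v < #|V| -> v \in ball S X (sdist S X v).
Proof.
move=> lt; have [k vk] : exists k, v \in ball S X k.
  have [/existsP[k vk]|/existsPn no] := boolP [exists k : 'I_#|V|, v \in ball S X k].
    by exists k.
  move: lt; rewrite /sdist (eq_bigr (fun=> 1)) ?sum1_card ?card_ord ?ltnn // => k _.
  by rewrite no.
have [m vm minm] := ex_minnP (ex_intro (fun k => v \in ball S X k) k vk).
suff <- : m = sdist S X v by [].
apply/eqP; rewrite eqn_leq sdist_le // andbT.
have mN : m <= #|V|.
  rewrite leqNgt; apply/negP => Nm; move: lt.
  rewrite /sdist (eq_bigr (fun=> 1)) ?sum1_card ?card_ord ?ltnn // => j _.
  apply/eqP; rewrite eqb1; apply/negP=> /minm; have := ltn_ord j; lia.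
rewrite /sdist -(big_mkord xpredT (fun k => (v \notin ball S X k) : nat)).
rewrite (big_cat_nat (n := m)) //=; apply: leq_trans (leq_addr _ _).
rewrite -[X in X <= _]subn0 -[X in X <= _]muln1 -sum_nat_const_nat !big_seq.
apply: leq_sum => j; rewrite mem_index_iota => /andP[_ jm].
by rewrite lt0b; apply/negP=> /minm; rewrite leqNgt jm.
Qed.

Lemma sdist_mono S S' X X' v : S \subset S' -> X \subset X' ->
  sdist S' X' v <= sdist S X v.
Proof.
move=> sS sX; apply: leq_sum => k _.
have := subsetP (ball_mono k sS sX) v.
by case: (v \in ball S X k) => [->|_] //; case: (_ \in _).
Qed.

Lemma sdist_self S X v : v \in X -> sdist S X v = 0.
Proof. by move=> vX; apply/eqP; rewrite -leqn0 sdist_le. Qed.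

Lemma sdistC S u v : u \in S -> v \in S -> sdist S [set u] v = sdist S [set v] u.
Proof.
move=> uS vS; apply: eq_bigr => k _; congr (nat_of_bool (~~ _)).
by apply/idP/idP; apply: ball_sym.
Qed.

Lemma sdist_trans S X u v : u \in S -> sdist S X v <= sdist S X u + sdist S [set u] v.
Proof.
move=> uS; have [lt1|] := ltnP (sdist S X u) #|V|; last first.
  by move=> h; apply: leq_trans (sdist_le_card _ _ _) _; apply: leq_trans h (leq_addr _ _).
have [lt2|] := ltnP (sdist S [set u] v) #|V|; last first.
  by move=> h; apply: leq_trans (sdist_le_card _ _ _) _; apply: leq_trans h (leq_addl _ _).
apply: sdist_le; rewrite ball_add; apply: (subsetP (ball_mono _ (subxx _) _)) (sdist_ball lt2).
by rewrite sub1set sdist_ball.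
Qed.

Lemma sdist_single S X v : X != set0 -> exists2 u, u \in X & sdist S [set u] v <= sdist S X v.
Proof.
case/set0Pn=> x xX; have [lt|ge] := ltnP (sdist S X v) #|V|; last first.
  by exists x => //; apply: leq_trans (sdist_le_card _ _ _) ge.
by have [u uX h] := ball_singleW (sdist_ball lt); exists u => //; apply: sdist_le.
Qed.

(** Turns bounds on how fast the complements of the balls shrink into bounds on sums of
    distances. *)
Lemma sum_sdist S X T : \sum_(v in T) sdist S X v = \sum_(k < #|V|) #|T :\: ball S X k|.
Proof.
rewrite exchange_big /=; apply: eq_bigr => k _; rewrite -[RHS]sum1_card big_mkcond /=.
rewrite [RHS]big_mkcond /=; apply: eq_bigr => v _; rewrite !inE.
by case: (v \in T); case: (v \in ball S X k).
Qed.

End Balls.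

(** * Sums of sequences that drop by a fixed amount until they reach zero *)

Lemma sum_decr2 (r : nat -> nat) N : (forall k, r k.+1 <= r k - 2) ->
  \sum_(k < N) r k <= (r 0).+1 ^ 2 %/ 4.
Proof.
elim: N r => [|N IH] r hr; first by rewrite big_ord0.
rewrite big_ord_recl /=; have {IH} := IH (fun k => r k.+1) (fun k => hr k.+1).
move=> /(leq_add (leqnn (r 0))) h; apply: leq_trans h _.
have := hr 0; case: (r 0) => [|[|m]] h; try by move: h; case: (r 1).
have : (r 1).+1 ^ 2 %/ 4 <= m.+1 ^ 2 %/ 4.
  by apply: leq_div2r; rewrite leq_exp2r //; lia.
move=> /(leq_add (leqnn m.+2)) h2; apply: leq_trans h2 _.
by rewrite -divnMDl // leq_div2r //; lia.
Qed.

(** As with steps of 2, the worst case is [r 0], [r 0 - 3], [r 0 - 6] and so on; the rounded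
    quotient is exactly its sum. *)
Lemma sum_decr3 (r : nat -> nat) N : (forall k, r k.+1 <= r k - 3) ->
  \sum_(k < N) r k <= (r 0).+1 * (r 0).+2 %/ 6.
Proof.
elim: N r => [|N IH] r hr; first by rewrite big_ord0.
rewrite big_ord_recl /=; have {IH} := IH (fun k => r k.+1) (fun k => hr k.+1).
move=> /(leq_add (leqnn (r 0))) h; apply: leq_trans h _.
have := hr 0; case: (r 0) => [|[|[|m]]] h; try by move: h; case: (r 1).
have : (r 1).+1 * (r 1).+2 %/ 6 <= m.+1 * m.+2 %/ 6.
  by apply: leq_div2r; apply: leq_mul; lia.
move=> /(leq_add (leqnn m.+3)) h2; apply: leq_trans h2 _.
by rewrite -divnMDl // leq_div2r //; lia.
Qed.

(** * Sparse and tight vertex sets *)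

Section Tight.

Variables (V : finType) (e : rel V).
Hypotheses (eC : symmetric e) (eI : irreflexive e).
Implicit Types (A B S X T P L Q : {set V}) (u v w x y : V).

Definition nb S u : {set V} := [set v in S | e u v].

Lemma in_nb S u v : (v \in nb S u) = (v \in S) && e u v.
Proof. by rewrite inE. Qed.

(* Edges inside [A :&: S] are counted twice. *)
Definition narcs A S := \sum_(u in A) #|nb S u|.

Lemma narcs_add S A B : [disjoint A & B] -> narcs (A :|: B) S = narcs A S + narcs B S.
Proof. by move=> dAB; rewrite /narcs -bigU //; apply: eq_bigl => v; rewrite !inE. Qed.

Lemma narcsE A S : narcs A S = \sum_(u in A) \sum_(v in S) e u v.
Proof.
apply: eq_bigr => u _; rewrite -sum1_card big_mkcond /= [RHS]big_mkcond /=.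
by apply: eq_bigr => v _; rewrite inE; case: (v \in S); case: (e u v).
Qed.

Lemma narcsC A S : narcs A S = narcs S A.
Proof.
rewrite !narcsE exchange_big /=; apply: eq_bigr => v _.
by apply: eq_bigr => u _; rewrite eC.
Qed.

Lemma narcs_addr S A B : [disjoint A & B] -> narcs S (A :|: B) = narcs S A + narcs S B.
Proof. by move=> dAB; rewrite narcsC narcs_add // !(narcsC S). Qed.

Lemma narcs_eq0 A S : (forall u v, u \in A -> v \in S -> ~~ e u v) -> narcs A S = 0.
Proof.
move=> h; rewrite narcsE big1 // => u uA; rewrite big1 // => v vS.
by rewrite (negbTE (h _ _ uA vS)).
Qed.

Lemma narcs_small S : narcs S S <= #|S| * #|S|.-1.
Proof.
rewrite -sum_nat_const; apply: leq_sum => u uS.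
rewrite (cardsD1 u S) uS add1n /=; apply: subset_leq_card.
by apply/subsetP=> v; rewrite !inE => /andP[-> uv]; rewrite andbT; apply: contraTneq uv => ->; rewrite eI.
Qed.

Lemma nbD1 S u : u \in S -> nb (S :\ u) u = nb S u.
Proof.
move=> uS; apply/setP=> v; rewrite !inE; case: eqP => //= ->.
by rewrite eI andbF.
Qed.

Lemma narcsD1 S u : u \in S -> narcs S S = narcs (S :\ u) (S :\ u) + 2 * #|nb S u|.
Proof.
move=> uS; have d : [disjoint [set u] & S :\ u].
  by rewrite -setI_eq0; apply/eqP/setP=> v; rewrite !inE; case: eqP.
rewrite -{1 2}(setD1K uS) narcs_add // !narcs_addr // (narcsC _ [set u]).
have -> : narcs [set u] (S :\ u) = #|nb S u| by rewrite /narcs big_set1 nbD1.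
suff -> : narcs [set u] [set u] = 0 by lia.
by apply: narcs_eq0 => x y; rewrite !inE => /eqP-> /eqP->; rewrite eI.
Qed.

(** The third part is [S :\: (P :|: L)], nonempty by properness; [L] may have any size, even
    zero. *)
Definition separates S P L :=
  [/\ P != set0, P :|: L \proper S, [disjoint P & L] &
      forall u v, u \in P -> v \in S -> e u v -> v \in P :|: L].

Lemma separates_compl S P L : separates S P L -> separates S (S :\: (P :|: L)) L.
Proof.
case=> P0 /properP[/subsetP sub [q qS qPL]] dPL sep; split.
- by apply/set0Pn; exists q; rewrite inE qPL.
- case/set0Pn: P0 => p pP; apply/properP; split.
    by apply/subsetP=> v; rewrite !inE => /orP[/andP[]//|vL]; apply: sub; rewrite inE vL orbT.
  exists p; first by apply: sub; rewrite inE pP.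
  by rewrite !inE pP /= (disjointFr dPL pP).
- by rewrite -setI_eq0; apply/eqP/setP=> v; rewrite !inE; case: (v \in L); rewrite ?orbT // andbF.
move=> u v; rewrite !inE negb_or => /andP[/andP[uP uL] uS] vS uv; rewrite vS andbT.
case vL: (v \in L); rewrite ?orbT // !orbF; apply/negP=> vP.
by have := sep v u vP uS; rewrite eC uv inE (negbTE uP) (negbTE uL) => /(_ isT).
Qed.

(** No edge joins [P] to [Q], so arcs and vertices obey inclusion-exclusion for two sides
    overlapping in [L]. *)
Lemma separates_narcs S P L : separates S P L ->
  let Q := S :\: (P :|: L) in
  [/\ narcs S S + narcs L L = narcs (P :|: L) (P :|: L) + narcs (Q :|: L) (Q :|: L),
      #|S| + #|L| = #|P :|: L| + #|Q :|: L|, #|P :|: L| = #|P| + #|L|,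
      #|Q :|: L| = #|Q| + #|L| & 0 < #|P| /\ 0 < #|Q|].
Proof.
move=> sepP /=; set Q := S :\: _.
have [Q0 _ dQL _] : separates S Q L by exact: separates_compl.
case: sepP => P0 /proper_sub sub dPL sep.
have dPQ : [disjoint P & Q].
  by rewrite -setI_eq0; apply/eqP/setP=> v; rewrite !inE; case: (v \in P).
have defS : S = P :|: L :|: Q by rewrite /Q setDE setUIr setUCr setIT; apply/esym/setUidPr.
have dPLQ : [disjoint P :|: L & Q].
  by rewrite -setI_eq0; apply/eqP/setP=> v; rewrite !inE; case: (v \in P); case: (v \in L).
have cPL : #|P :|: L| = #|P| + #|L|.
  by rewrite cardsU (disjoint_setI0 dPL) cards0 subn0.
have cQL : #|Q :|: L| = #|Q| + #|L|.
  by rewrite cardsU (disjoint_setI0 dQL) cards0 subn0.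
have cS : #|S| = #|P :|: L| + #|Q|.
  by rewrite [in LHS]defS cardsU (disjoint_setI0 dPLQ) cards0 subn0.
split=> //; last by rewrite !card_gt0.
  have PQ : narcs P Q = 0.
    apply: narcs_eq0 => u v uP; rewrite inE => /andP[vPL vS]; apply: contra vPL.
    exact: sep.
  rewrite [in LHS]defS !(narcs_add, narcs_addr) // PQ (narcsC Q P) PQ.
  rewrite (narcsC Q L) (narcsC L P); lia.
lia.
Qed.

Lemma ball_separates S X k : X \subset S -> X != set0 -> ball e S X k.+1 != S ->
  separates S (ball e S X k) (ball e S X k.+1 :\: ball e S X k).
Proof.
move=> XS X0 ne; have sub := ball_sub e k.+1 XS.
have eqB : ball e S X k :|: (ball e S X k.+1 :\: ball e S X k) = ball e S X k.+1.
  by rewrite setDE setUIr setUCr setIT; apply/setUidPr/ball_le.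
split.
- case/set0Pn: X0 => x xX; apply/set0Pn; exists x.
  exact: (subsetP (ball_le e S X (leq0n k))).
- by rewrite eqB properEneq ne sub.
- by rewrite -setI_eq0; apply/eqP/setP=> v; rewrite !inE; case: (v \in ball _ _ _ _).
by move=> u v uB vS uv; rewrite eqB; apply: ball_step uB vS uv.
Qed.

(** Each sphere separates the ball inside it from the rest until the balls exhaust [S]; then the
    left-hand side is zero. *)
Lemma ball_growth c S X k : X \subset S -> X != set0 ->
  (forall P L, separates S P L -> c <= #|L|) ->
  #|S :\: ball e S X k.+1| <= #|S :\: ball e S X k| - c.
Proof.
move=> XS X0 h; have [->|/(ball_separates XS X0)] := eqVneq (ball e S X k.+1) S.
  by rewrite setDv cards0.
move=> /h; have s1 := ball_sub e k XS; have s2 := ball_sub e k.+1 XS.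
have s3 := ball_le e S X (leqnSn k).
rewrite !cardsD (setIidPr s3) (setIidPr s2) (setIidPr s1).
have := subset_leq_card s1; have := subset_leq_card s2; have := subset_leq_card s3.
lia.
Qed.

(** The small side is now what lies beyond the sphere: it touches neither the inner ball nor, lying
    inside [P], the part of [S] across [L]. *)
Lemma ball_side_separates S P L k : separates S P L ->
  let B := ball e (P :|: L) L in B k.+1 != P :|: L ->
  separates S ((P :|: L) :\: B k.+1) (B k.+1 :\: B k).
Proof.
move=> [P0 PLS dPL sep] B ne.
have LPL : L \subset P :|: L by exact: subsetUr.
have sub j : B j \subset P :|: L by exact: ball_sub.
have LB j : L \subset B j by exact: (ball_le e (P :|: L) L (leq0n j)).
have [/subsetP PLS' [q qS qPL]] := properP PLS.
split.
- by apply: contraNneq ne => /eqP; rewrite setD_eq0 eqEsubset sub => ->.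
- apply: sub_proper_trans PLS; rewrite subUset subsetDl /=.
  by apply: subset_trans (subsetDl _ _) (sub _).
- rewrite -setI_eq0; apply/eqP/setP=> v; rewrite in_setI !in_setD in_set0.
  by case: (v \in B k.+1); rewrite ?andbF.
move=> u v; rewrite in_setD => /andP[uB uPL] vS uv.
have uP : u \in P.
  by move: uPL; rewrite inE => /orP[]// /(subsetP (LB k.+1)); rewrite (negbTE uB).
have vPL := sep _ _ uP vS uv.
rewrite in_setU !in_setD vPL andbT; case: (boolP (v \in B k.+1)) => //= vB; rewrite andbT.
by apply: contra uB => vBk; apply: ball_step vBk uPL _; rewrite eC.
Qed.

(** Separators being nonempty, each sphere contains a point of [P]; the part beyond it is thus
    smaller than [P], and the hypothesis on smaller separations applies. *)
Lemma ball_side_growth c S P L k : separates S P L ->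
  (forall P' L', separates S P' L' -> 0 < #|L'|) ->
  (forall P' L', #|P'| < #|P| -> separates S P' L' -> c <= #|L'|) ->
  #|P :\: ball e (P :|: L) L k.+1| <= #|P :\: ball e (P :|: L) L k| - c.
Proof.
move=> sepP h1 hc; set B := ball e (P :|: L) L.
have LB j : L \subset B j by exact: (ball_le e (P :|: L) L (leq0n j)).
have eqP j : P :\: B j = (P :|: L) :\: B j.
  by rewrite setDUl (_ : L :\: B j = set0) ?setU0 //; apply/eqP; rewrite setD_eq0.
have sub j : B j \subset P :|: L by apply: ball_sub; exact: subsetUr.
have s3 : B k \subset B k.+1 by exact: ball_le.
have [E|/(ball_side_separates sepP)] := eqVneq (B k.+1) (P :|: L).
  by rewrite eqP E setDv cards0.
rewrite -/B => sep'; have := h1 _ _ sep'; rewrite card_gt0 => /set0Pn[w]; rewrite inE => /andP[wk wk1].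
have wP : w \in P.
  have := subsetP (sub k.+1) _ wk1; rewrite inE => /orP[//|/(subsetP (LB k))].
  by rewrite (negbTE wk).
have /hc/(_ sep') : #|(P :|: L) :\: B k.+1| < #|P|.
  rewrite -eqP; apply: proper_card; apply/properP; split; first exact: subsetDl.
  by exists w; rewrite // inE wk1.
rewrite !eqP !cardsD (setIidPr (sub k)) (setIidPr (sub k.+1)) (setIidPr s3).
have := subset_leq_card (sub k); have := subset_leq_card (sub k.+1).
have := subset_leq_card s3; lia.
Qed.

Definition tight S := narcs S S + 8 = 4 * #|S|.

Hypothesis sparse : forall T, 3 <= #|T| -> narcs T T + 8 <= 4 * #|T|.

Lemma narcs_le T : 1 < #|T| -> narcs T T + 6 <= 4 * #|T|.
Proof.
rewrite leq_eqVlt => /orP[/eqP T2|/sparse]; last by lia.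
by have := narcs_small T; rewrite -T2; lia.
Qed.

(** For sides sharing at most one vertex, the edge bounds sum to less than [4 * #|S| - 8]. Sides
    with one or two vertices need their own bounds. The path on three vertices is tight and has a
    cut vertex, whence [4 <= #|S|]. *)
Lemma tight_separates S P L : tight S -> 4 <= #|S| -> separates S P L -> 2 <= #|L|.
Proof.
move=> tS S4 /separates_narcs[]; set Q := S :\: _ => eqn cS cPL cQL [p0 q0].
rewrite ltnNge; apply/negP => L1.
have sm T : #|T| <= 1 -> narcs T T = 0.
  by move=> T1; apply/eqP; rewrite -leqn0; apply: leq_trans (narcs_small T) _; case: #|T| T1 => [|[]].
move: eqn; rewrite (sm L) // addn0 => eqn.
have bd T : (#|T| <= 1 /\ narcs T T = 0) \/ (#|T| = 2 /\ narcs T T + 6 <= 4 * #|T|)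
    \/ (3 <= #|T| /\ narcs T T + 8 <= 4 * #|T|).
  have [|T1] := leqP #|T| 1; first by left; rewrite sm.
  have [T3|T2] := ltnP 2 #|T|; first by right; right; split=> //; exact: sparse.
  by right; left; split; [lia | exact: narcs_le].
move: tS (bd (P :|: L)) (bd (Q :|: L)); rewrite /tight; lia.
Qed.

(** The sparsity bounds of the sides sum to [4 * #|S| - 8], the exact count in [S]; so they are
    equalities and [L] spans no edge. *)
Lemma tight_sides S P L : tight S -> separates S P L -> #|L| = 2 ->
  tight (P :|: L) /\ narcs L L = 0.
Proof.
move=> tS /separates_narcs[]; set Q := S :\: _ => eqn cS cPL cQL [p0 q0] L2.
have h1 : narcs (P :|: L) (P :|: L) + 8 <= 4 * #|P :|: L| by apply: sparse; lia.
have h2 : narcs (Q :|: L) (Q :|: L) + 8 <= 4 * #|Q :|: L| by apply: sparse; lia.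
by move: tS; rewrite /tight; split; lia.
Qed.

Lemma tight_deg S u : tight S -> 4 <= #|S| -> u \in S -> 2 <= #|nb S u|.
Proof.
move=> tS S4 uS; have := cardsD1 u S; rewrite uS /= => cS.
have := narcsD1 uS; have := sparse (T := S :\ u); move: tS; rewrite /tight; lia.
Qed.

Lemma tight_del S u : tight S -> u \in S -> #|nb S u| = 2 -> tight (S :\ u).
Proof.
move=> tS uS d2; have := cardsD1 u S; rewrite uS /= => cS.
have := narcsD1 uS; move: tS; rewrite /tight; lia.
Qed.

Definition transm S u := \sum_(v in S) sdist e S [set u] v.

Definition wsum S := \sum_(u in S) transm S u.

(** Deleting [u] can only increase the other distances, and each pair with [u] occurs in both
    orders. *)
Lemma wsum_del S u : u \in S -> wsum S <= wsum (S :\ u) + 2 * transm S u.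
Proof.
move=> uS; rewrite /wsum (big_setD1 u) //=.
have h : \sum_(v in S :\ u) transm S v <=
    \sum_(v in S :\ u) (sdist e S [set u] v + transm (S :\ u) v).
  apply: leq_sum => v; rewrite in_setD1 => /andP[vu vS]; rewrite /transm (big_setD1 u) //=.
  rewrite (sdistC eC vS uS) leq_add2l; apply: leq_sum => w _.
  by apply: sdist_mono => //; exact: subsetDl.
rewrite big_split /= in h.
have : \sum_(v in S :\ u) sdist e S [set u] v <= transm S u.
  by rewrite /transm [X in _ <= X](big_setD1 u) //= leq_addl.
lia.
Qed.

Lemma card_compl_ball0 S u : u \in S -> #|S :\: ball e S [set u] 0| = #|S|.-1.
Proof. by move=> uS; rewrite (cardsD1 u S) uS. Qed.

Lemma ball1E S u : u \in S -> ball e S [set u] 1 = u |: nb S u.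
Proof.
move=> uS; apply/setP=> v; rewrite /= !inE; congr (_ || (_ && _)).
apply/existsP/idP => [[w /andP[]]|uv]; first by rewrite inE => /eqP->.
by exists u; rewrite inE eqxx.
Qed.

Lemma card_compl_ball1 S u : u \in S -> #|S :\: ball e S [set u] 1| = #|S| - #|nb S u|.+1.
Proof.
move=> uS; have sub : ball e S [set u] 1 \subset S by apply: ball_sub; rewrite sub1set.
by rewrite cardsD (setIidPr sub) ball1E // cardsU1 inE eI andbF.
Qed.

Lemma transm_le S u : tight S -> 4 <= #|S| -> u \in S -> transm S u <= #|S| ^ 2 %/ 4.
Proof.
move=> tS S4 uS; rewrite /transm sum_sdist.
have := @sum_decr2 (fun k => #|S :\: ball e S [set u] k|) #|V|.
rewrite card_compl_ball0 // prednK ?(leq_trans _ S4) //; apply => k.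
apply: ball_growth; rewrite ?sub1set //; last by move=> P L; exact: tight_separates.
by apply/set0Pn; exists u; rewrite inE.
Qed.

Lemma leq_sum_shift (r : nat -> nat) N : \sum_(k < N) r k <= r 0 + \sum_(k < N) r k.+1.
Proof.
case: N => [|N]; first by rewrite !big_ord0.
by rewrite big_ord_recl big_ord_recr /= leq_add2l leq_addr.
Qed.

(** With [n = #|S|], the complements of the balls have [n - 1], [n - 3] and at most [n - 6] points
    and then lose at least two at a time, for a total of at most
    [(n - 1) + (n - 3) + (n - 5) ^ 2 / 4]. If the second ball is [S], the claim reduces to
    [(n - 5) ^ 2 >= 0]. *)
Lemma transm_le_ball2 S u : tight S -> 4 <= #|S| -> u \in S ->
  #|nb S u| = 2 -> ball e S [set u] 2 = S \/ 6 <= #|ball e S [set u] 2| -> 5 <= #|S| ->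
  4 * transm S u + 2 * #|S| <= #|S| ^ 2 + 9.
Proof.
move=> tS S4 uS d2 b2 S5; rewrite /transm sum_sdist.
set r := fun k => #|S :\: ball e S [set u] k|.
have r0 : r 0 = #|S|.-1 by exact: card_compl_ball0.
have r1 : r 1 = #|S| - 3 by rewrite /r card_compl_ball1 // d2.
have uSs : [set u] \subset S by rewrite sub1set.
have r2 : r 2 = 0 \/ (6 <= #|S| /\ r 2 <= #|S| - 6).
  have sub := ball_sub e 2 uSs.
  case: b2 => [E|b6]; first by left; rewrite /r E setDv cards0.
  right; split; first exact: leq_trans b6 (subset_leq_card sub).
  by rewrite /r cardsD (setIidPr sub) leq_sub2l.
have h2 : \sum_(k < #|V|) r k.+2 <= (r 2).+1 ^ 2 %/ 4.
  apply: (@sum_decr2 (fun k => r k.+2)) => k.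
  apply: ball_growth => //; last by move=> P L; exact: tight_separates.
  by apply/set0Pn; exists u; rewrite inE.
have i1 : \sum_(k < #|V|) r k <= #|S|.-1 + \sum_(k < #|V|) r k.+1.
  by rewrite -r0; exact: leq_sum_shift.
have i2 : \sum_(k < #|V|) r k.+1 <= #|S| - 3 + \sum_(k < #|V|) r k.+2.
  by rewrite -r1; exact: (leq_sum_shift (fun k => r k.+1)).
have i3 : \sum_(k < #|V|) r k <= #|S|.-1 + (#|S| - 3 + (r 2).+1 ^ 2 %/ 4).
  by apply: leq_trans i1 _; rewrite leq_add2l; apply: leq_trans i2 _; rewrite leq_add2l.
case: r2 => [E|[S6 r2]].
  have [m E'] : exists m, #|S| = m + 5 by exists (#|S| - 5); lia.
  move: i3; rewrite E E' (_ : 1 ^ 2 %/ 4 = 0) //; move: (\sum_(_ < _) _) => s; nia.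
have i4 : (r 2).+1 ^ 2 %/ 4 * 4 <= (r 2).+1 ^ 2 by exact: leq_trunc_div.
have i5 : (r 2).+1 ^ 2 <= (#|S| - 5) ^ 2 by rewrite leq_exp2r //; lia.
have [m E] : exists m, #|S| = m + 6 by exists (#|S| - 6); lia.
move: i3 i4 i5; rewrite E; 
move: ((r 2).+1 ^ 2) => w; move: (w %/ 4) => t; move: (\sum_(_ < _) _) => s.
rewrite (_ : m + 6 - 5 = m.+1); last by lia.
nia.
Qed.

End Tight.

(** * The Wiener index of tight triangle-free graphs *)

(* The claimed bound on the Wiener index, multiplied by 12; [w] is a sum over ordered
   pairs of vertices, that is, twice the index. *)
Definition wiener_bound n w :=
  if odd n then 6 * w + 12 <= n ^ 3 + 11 * n else 6 * w + 24 <= n ^ 3 + 14 * n.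

(** Two successive deletions keep [n] odd. Rounded down to integers, the bounds on [c] and [c'] add
    up to exactly the increment. *)
Lemma wiener_bound_step2 n w w' w'' c c' : odd n -> 7 <= n ->
  w <= w' + 2 * c -> w' <= w'' + 2 * c' -> 4 * c <= n ^ 2 ->
  4 * c' + 2 * n.-1 <= n.-1 ^ 2 + 9 -> wiener_bound (n - 2) w'' -> wiener_bound n w.
Proof.
move=> on n7 i1 i2 i3 i4; rewrite /wiener_bound oddB ?(leq_trans _ n7) // on /=.
have [k E] : exists k, n = k.*2.+1 by exists n./2; rewrite -[LHS]odd_double_half on.
have [j Ej] : exists j, n = 2 * j + 7 by exists (k - 3); lia.
rewrite Ej (_ : 2 * j + 7 - 2 = 2 * j + 5); last by lia.
have {}i3 : c <= j ^ 2 + 7 * j + 12 by rewrite Ej in i3; lia.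
have {}i4 : c' <= j ^ 2 + 5 * j + 8.
  by move: i4; rewrite Ej (_ : (2 * j + 7).-1 = 2 * j + 6); [lia | lia].
move: i1 i2 i3 i4; clear; lia.
Qed.

(** * Three vertices, and deletion of a vertex of degree 2 *)

Section SmallDegree.

Variables (V : finType) (e : rel V).
Hypotheses (eC : symmetric e) (eI : irreflexive e).
Hypothesis sparse : forall T : {set V}, 3 <= #|T| -> narcs e T T + 8 <= 4 * #|T|.
Hypothesis trifree : forall u v w, e u v -> e v w -> ~~ e u w.
Implicit Types (S P L Q T : {set V}) (u v w x y : V).

Lemma wiener_bound3 S : tight e S -> #|S| = 3 -> wiener_bound #|S| (wsum e S).
Proof.
move=> tS S3; rewrite /wiener_bound S3 /=.
(* [S] is a path on three vertices, with ordered distances adding up to [2 * (1 + 1 + 2)]; [v] below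
   is its midpoint. *)
suff : wsum e S <= 8 by lia.
have n4 : narcs e S S = 4 by move: tS; rewrite /tight S3; lia.
have [v vS d2] : exists2 v, v \in S & 2 <= #|nb e S v|.
  apply/exists_inP; rewrite -[X in is_true X]negbK negb_exists_in; apply/negP=> /forall_inP h.
  have : narcs e S S <= \sum_(v in S) 1.
    by apply: leq_sum => v /h; rewrite -leqNgt.
  by rewrite n4 sum1_card S3.
have nbv : nb e S v = S :\ v.
  apply/eqP; rewrite eqEcard; apply/andP; split.
    apply/subsetP=> w; rewrite !inE => /andP[-> vw]; rewrite andbT.
    by apply: contraTneq vw => ->; rewrite eI.
  by apply: leq_trans d2; move: S3; rewrite (cardsD1 v) vS; lia.
have b1 w : w \in S -> w \in ball e S [set v] 1.
  move=> wS; rewrite ball1E // nbv; rewrite !inE wS andbT; exact: orbN.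
have dv w : w \in S -> sdist e S [set v] w <= (w != v).
  move=> wS; have [->|wv] := eqVneq w v; first by rewrite sdist_self ?inE.
  exact/sdist_le/b1.
have dw u w : u \in S -> w \in S -> sdist e S [set u] w <= (u != v) + (w != v).
  move=> uS wS; apply: leq_trans (sdist_trans _ _ _ vS) _.
  by apply: leq_add; rewrite ?dv // sdistC // dv.
have cD1 : #|S :\ v| = 2 by move: S3; rewrite (cardsD1 v) vS; lia.
have transv : transm e S v <= 2.
  rewrite -cD1 -sum1_card /transm (big_setD1 v) //= sdist_self ?inE // add0n.
  apply: leq_sum => w; rewrite !inE => /andP[wv wS].
  by apply: leq_trans (dv _ wS) _; rewrite wv.
have transu u : u \in S :\ v -> transm e S u <= 3.
  rewrite !inE => /andP[uv uS]; rewrite /transm (big_setD1 v) //=.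
  have h1 : sdist e S [set u] v <= 1 by have := dw u v uS vS; rewrite eqxx uv.
  have uSv : u \in S :\ v by rewrite !inE uv.
  have c1 : #|(S :\ v) :\ u| = 1 by move: cD1; rewrite (cardsD1 u) uSv; lia.
  rewrite (big_setD1 u) //= (@sdist_self _ e S [set u] u) ?inE // add0n.
  suff : \sum_(w in (S :\ v) :\ u) sdist e S [set u] w <= \sum_(w in (S :\ v) :\ u) 2.
    by rewrite sum_nat_const c1; lia.
  apply: leq_sum => w; rewrite !inE => /andP[_ /andP[_ wS]].
  by apply: leq_trans (dw _ _ uS wS) _; case: (u != v); case: (w != v).
rewrite /wsum (big_setD1 v) //=.
suff : \sum_(u in S :\ v) transm e S u <= \sum_(u in S :\ v) 3.
  by rewrite sum_nat_const cD1; lia.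
exact: leq_sum.
Qed.

(** On the scale of [wiener_bound], the increment from [n - 1] to an even [n] is [3 * n ^ 2],
    exactly 12 times the transmission bound [n ^ 2 / 4]. *)
Lemma wiener_bound_even S v : tight e S -> 4 <= #|S| -> ~~ odd #|S| -> v \in S ->
  #|nb e S v| = 2 -> wiener_bound #|S|.-1 (wsum e (S :\ v)) ->
  wiener_bound #|S| (wsum e S).
Proof.
move=> tS S4 evS vS d2; rewrite /wiener_bound (negbTE evS).
have -> : odd #|S|.-1 by move: evS S4; case: #|S| => //= m; rewrite negbK.
have := wsum_del eC vS; have h := transm_le eC eI sparse tS S4 vS.
have h4 : 4 * transm e S v <= #|S| ^ 2.
  by rewrite mulnC -leq_divRL.
move: (wsum _ _) (wsum _ _) (transm _ _ _) h4 S4 => w w' c.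
case: #|S| => // m /=; nia.
Qed.

(** The second sphere separates, so it has at least two points, and by the size of the ball at most
    two; hence the ball is tight. Without [v] it is a tight set of four vertices, where [x] has
    degree at least 2; by triangle-freeness its neighbours lie in the second sphere and fill it. *)
Lemma nb_deg2_sphere S v x : tight e S -> 4 <= #|S| -> v \in S -> #|nb e S v| = 2 ->
  let B := ball e S [set v] in B 2 != S -> #|B 2| <= 5 -> x \in nb e S v ->
  nb e (S :\ v) x = B 2 :\: B 1 /\ #|B 2 :\: B 1| = 2.
Proof.
move=> tS S4 vS d2 B ne le5 xv.
have vsub : [set v] \subset S by rewrite sub1set.
have v0 : [set v] != set0 by apply/set0Pn; exists v; rewrite inE.
have sep := @ball_separates _ e _ _ 1 vsub v0 ne; rewrite -/B in sep.
set L := B 2 :\: B 1 in sep *.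
have L2 := tight_separates eC eI sparse tS S4 sep.
have B12 : B 1 \subset B 2 by exact: ball_le.
have B2S : B 2 \subset S by exact: ball_sub.
have eB2 : B 1 :|: L = B 2 by rewrite /L setDE setUIr setUCr setIT; apply/setUidPr.
have cB1 : #|B 1| = 3 by rewrite /B ball1E // cardsU1 inE eI andbF d2.
have cL : #|L| = 2.
  by move: L2 le5; rewrite /L cardsD (setIidPr B12) cB1; lia.
split=> //.
have [tB2 _] := tight_sides eC sparse tS sep cL; rewrite eB2 in tB2.
have vB2 : v \in B 2 by apply: (subsetP (ball_le e S [set v] (leq0n 2))); rewrite inE.
have B1E : B 1 = v |: nb e S v by rewrite /B ball1E.
have nbv : nb e (B 2) v = nb e S v.
  apply/setP=> w; rewrite !in_nb; case vw: (e v w); rewrite ?andbF // !andbT.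
  apply/idP/idP => [/(subsetP B2S)//|wS]; apply: (subsetP B12).
  by rewrite B1E !inE wS vw orbT.
have tU : tight e (B 2 :\ v) by apply: (tight_del eC eI tB2 vB2); rewrite nbv.
have cB2 : #|B 2| = 5 by rewrite -eB2 cardsU cB1 cL /L setDE setICA setICr setI0 cards0.
have cU : #|B 2 :\ v| = 4 by move: cB2; rewrite (cardsD1 v) vB2; lia.
move: (xv); rewrite inE => /andP[xS vx].
have xB1 : x \in B 1 by rewrite B1E !inE xS vx orbT.
have xU : x \in B 2 :\ v.
  by rewrite in_setD1 (subsetP B12) // andbT; apply: contraTneq vx => ->; rewrite eI.
have dx : 2 <= #|nb e (B 2 :\ v) x| by apply: tight_deg; rewrite ?cU.
have sub1 : nb e (B 2 :\ v) x \subset L.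
  apply/subsetP=> w; rewrite in_nb in_setD1 => /andP[/andP[wv wB2] xw].
  rewrite in_setD wB2 andbT B1E in_setU1 (negbTE wv) /= in_nb negb_and.
  by apply/orP; right; apply: trifree vx xw.
have E : nb e (B 2 :\ v) x = L by apply/eqP; rewrite eqEcard sub1 cL.
rewrite -E; apply/setP=> w; rewrite !in_nb !in_setD1.
case xw: (e x w); rewrite ?andbF // !andbT; congr (_ && _).
apply/idP/idP => [wS|]; last by move/(subsetP B2S).
by apply: (ball_step xB1 wS xw).
Qed.

(* If the first two spheres around [v] have two points each, they span a
   4-cycle and a neighbour [x] of [v] gets degree 2 in [S :\ v].  There the other
   neighbour [y] of [v] is a dead end of the second sphere around [x], which therefore
   has a third point. *)
Lemma wiener_bound_odd S v : tight e S -> 4 <= #|S| -> odd #|S| -> v \in S ->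
  #|nb e S v| = 2 ->
  (forall T, #|T| < #|S| -> 3 <= #|T| -> tight e T -> wiener_bound #|T| (wsum e T)) ->
  wiener_bound #|S| (wsum e S).
Proof.
move=> tS S4 oS vS d2 IH.
have S5 : 5 <= #|S| by move: S4 oS; case: #|S| => [|[|[|[|[]]]]].
have tS' := tight_del eC eI tS vS d2.
have cS' : #|S :\ v| = #|S|.-1 by rewrite (cardsD1 v S) vS.
have w1 := wsum_del eC vS.
pose B := ball e S [set v].
have [far|] := boolP ((B 2 == S) || (5 < #|B 2|)).
  have h := transm_le_ball2 eC eI sparse tS S4 vS d2.
  (* This sharper bound is exactly the increment from [n - 1] to an odd [n]. *)
  have {}h : 4 * transm e S v + 2 * #|S| <= #|S| ^ 2 + 9.
    by apply: h => //; case/orP: far => [/eqP|]; [left | right].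
  have := IH (S :\ v); rewrite cS' /wiener_bound oS.
  have -> : odd #|S|.-1 = false by move: oS S4; case: #|S| => //= m /negbTE.
  move=> /(_ _ _ tS') h2; move: h h2 w1 S5 {S4 oS far IH tS tS' cS'}.
  move: (wsum _ _) (wsum _ _) (transm _ _ _) => w w' c.
  by case: #|S| => // m /= h h2 w1 S5; have := h2 _ _; nia.
rewrite negb_or -leqNgt => /andP[ne le5].
have key := nb_deg2_sphere tS S4 vS d2 ne le5; rewrite -/B in key.
set L := B 2 :\: B 1 in key.
have [x xv] : exists x, x \in nb e S v by apply/set0Pn; rewrite -card_gt0 d2.
have [nbx cL] := key x xv.
have xS' : x \in S :\ v.
  move: xv; rewrite !inE => /andP[-> vx]; rewrite andbT.
  by apply: contraTneq vx => ->; rewrite eI.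
have dx : #|nb e (S :\ v) x| = 2 by rewrite nbx.
have [y yv yx] : exists2 y, y \in nb e S v & y != x.
  have : 0 < #|nb e S v :\ x| by move: d2; rewrite (cardsD1 x) xv; lia.
  by rewrite card_gt0 => /set0Pn[y]; rewrite in_setD1 => /andP[yx yv]; exists y.
have [nby _] := key y yv.
have yS' : y \in S :\ v.
  move: yv; rewrite !inE => /andP[-> vy]; rewrite andbT.
  by apply: contraTneq vy => ->; rewrite eI.
(* [S] properly contains a ball of five points and has odd size. *)
have S7 : 7 <= #|S|.
  have : B 2 \proper S by rewrite properEneq ne ball_sub // sub1set.
  move/proper_card; suff -> : #|B 2| = 5 by move: oS; case: #|S| => [|[|[|[|[|[|[]]]]]]].
  have B12 : B 1 \subset B 2 by exact: ball_le.
  have cB1 : #|B 1| = 3 by rewrite /B ball1E // cardsU1 inE eI andbF d2.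
  by move: cL (subset_leq_card B12); rewrite /L cardsD (setIidPr B12) cB1; clear; lia.
have xsub : [set x] \subset S :\ v by rewrite sub1set.
pose C := ball e (S :\ v) [set x].
have C1E : C 1 = x |: L by rewrite /C ball1E // nbx.
have farx : C 2 = S :\ v \/ 6 <= #|C 2|.
  have [E|neC] := eqVneq (C 2) (S :\ v); [by left | right].
  have C2S : C 2 \subset S :\ v by exact: ball_sub.
  have C12 : C 1 \subset C 2 by exact: ball_le.
  have [a aL] : exists a, a \in L by apply/set0Pn; rewrite -card_gt0 cL.
  have ya : e y a by move: aL; rewrite -nby inE => /andP[].
  have yC2 : y \in C 2.
    by apply: (@ball_step _ e _ _ 1 a) => //; [rewrite -/C C1E inE aL orbT | rewrite eC].
  have vy : e v y by move: yv; rewrite inE => /andP[].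
  have yL : y \notin L.
    rewrite -nbx inE negb_and; apply/orP; right.
    by move: xv; rewrite inE => /andP[_ vx]; apply: (trifree _ vy); rewrite eC.
  have yC1 : y \notin C 1 by rewrite C1E in_setU1 negb_or yx.
  have eqC : (y |: C 1) :|: ((C 2 :\: C 1) :\ y) = C 2.
    apply/setP=> w; rewrite in_setU in_setU1 in_setD1 in_setD.
    have [->|_] := eqVneq w y; first by rewrite yC2.
    by case: (boolP (w \in C 1)) => //= /(subsetP C12) ->.
  (* In [S :\ v] the neighbours of [y] lie in [C 1], so [y] may move to the inner side; the rest of
     the second sphere still separates and has at least two points. *)
  have sepC : separates e (S :\ v) (y |: C 1) ((C 2 :\: C 1) :\ y).
    split.
    - by apply/set0Pn; exists y; rewrite !inE eqxx.
    - by rewrite eqC properEneq neC.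
    - rewrite -setI_eq0; apply/eqP/setP=> w.
      by rewrite in_setI in_setU1 in_setD1 in_setD in_set0; case: eqP => //= _; case: (w \in C 1).
    move=> u w; rewrite eqC in_setU1 => /orP[/eqP->|uC] wS uw; last exact: ball_step uC wS uw.
    apply: (subsetP C12); rewrite C1E in_setU1 -nby.
    by rewrite in_nb wS uw orbT.
  have := tight_separates eC eI sparse tS' _ sepC; rewrite cS'.
  have -> : #|C 2| = #|C 1| + #|(C 2 :\: C 1) :\ y|.+1.
    have <- : #|C 2 :\: C 1| = #|(C 2 :\: C 1) :\ y|.+1.
      by rewrite [in LHS](cardsD1 y) in_setD yC2 yC1.
    by rewrite -(cardsID (C 1) (C 2)) (setIidPr C12).
  have -> : #|C 1| = 3 by rewrite C1E cardsU1 cL -nbx in_nb eI andbF.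
  have S'4 : 3 < #|S|.-1 by rewrite -subn1 ltn_subRL; apply: leq_trans S7.
  by move=> /(_ S'4); rewrite addnS.
have w2 := wsum_del eC xS'.
have c1 := transm_le eC eI sparse tS S4 vS.
have c2 := transm_le_ball2 eC eI sparse tS' _ xS' dx farx.
have tS'' := tight_del eC eI tS' xS' dx.
have cS'' : #|(S :\ v) :\ x| = #|S| - 2.
  by rewrite subn2 -cS' [in RHS](cardsD1 x) xS'.
have c1' : 4 * transm e S v <= #|S| ^ 2.
  by rewrite mulnC -leq_divRL.
move: c2; rewrite cS' => c2; apply: (wiener_bound_step2 oS S7 w1 w2 c1' (c2 _ _)).
- by rewrite -subn1 ltn_subRL; apply: leq_trans S7.
- by rewrite -subn1 ltn_subRL; apply: leq_trans S7.
rewrite -cS''; apply: IH tS''; rewrite cS''.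
  by rewrite ltn_subrL (leq_trans _ S7).
by rewrite leq_subRL ?(leq_trans _ S7).
Qed.

End SmallDegree.

(** * Arithmetic of gluing the bounds along a 2-separation *)

Lemma leq4_sqr_odd m n : 4 * m <= n ^ 2 -> 4 * m + odd n <= n ^ 2.
Proof.
have [k [b [-> ->]]] : exists k b, n = 2 * k + b /\ b = odd n by exists n./2, (odd n); lia.
by case: (odd n); clear; lia.
Qed.

Lemma cube_glue s t :
  (s + t + 2) ^ 3 + 8 = (s + 2) ^ 3 + (t + 2) ^ 3 + 3 * (s * s * t) + 3 * (s * (t * t)) + 12 * (s * t).
Proof. lia. Qed.

(** [s] and [t] stand for [#|P|] and [#|Q|]; [M] bounds the distances from [P] to [L], [K] those
    from a point of [L] to [Q], [X] those across. The 4 comes from the pair [L], at distance at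
    least 2 in both orders and counted on both sides. *)
Lemma wiener_bound_glue s t M K w wA wB X :
  [\/ s = 4 /\ M <= 4, s = 5 /\ M <= 6 | 6 <= s /\ M <= s.+1 * s.+2 %/ 6] ->
  4 * (K + 2) <= (t + 2) ^ 2 ->
  w + 4 <= wA + wB + 2 * X -> X <= t * M + s * K ->
  wiener_bound (s + 2) wA -> wiener_bound (t + 2) wB -> wiener_bound (s + t + 2) w.
Proof.
move=> sM /leq4_sqr_odd hK hw hX.
have {hK} sK : 4 * (s * K) + 8 * s + s * odd t <= s * (t * t) + 4 * (s * t) + 4 * s.
  have : s * (4 * (K + 2) + odd (t + 2)) <= s * (t + 2) ^ 2 by rewrite leq_mul2l hK orbT.
  by rewrite oddD addbF; clear; lia.
have tM : 12 * (t * M) + 3 * (t * odd s) <= 3 * (s * s * t).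
  (* For the largest admissible [M] this is an equality at [s = 4, 5, 6, 7]. The general formula for
     [M] would violate it at 4 and 5, hence their separate values. *)
  suff : 12 * M + 3 * odd s <= 3 * (s * s) by move=> /(leq_mul (leqnn t)); clear; lia.
  case: sM => [[-> ?]|[-> ?]|[s6 hM]]; [by lia | by lia |].
  move: s6; rewrite leq_eqVlt => /orP[/eqP s6|s7]; first by rewrite -s6 in hM *; lia.
  have : 6 * M <= s.+1 * s.+2 by rewrite mulnC -leq_divRL.
  have : 7 * s <= s * s by rewrite leq_mul2r s7 orbT.
  by have := leq_b1 (odd s); move: s7; clear; lia.
move: sK tM hw hX (cube_glue s t); rewrite /wiener_bound !oddD !addbF.
move: ((s + 2) ^ 3) ((t + 2) ^ 3) ((s + t + 2) ^ 3) (t * M) (s * K) => a b c d f.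
move: (s * s * t) (s * (t * t)) (s * t) => g h i.
case: (odd s); case: (odd t) => /=; rewrite !(muln0, muln1); clear; lia.
Qed.

(** The case [s = 5], [M = 7], which violates the estimate above: three vertices of [P] are charged
    [K] and two [K']. *)
Lemma wiener_bound_glue5 t K K' w wA wB X :
  4 * (K + 2) <= (t + 2) ^ 2 -> 4 * K' <= t.+1 ^ 2 ->
  w + 4 <= wA + wB + 2 * X -> X <= t * 7 + 3 * K + 2 * K' -> 
  wiener_bound 7 wA -> wiener_bound (t + 2) wB -> wiener_bound (5 + t + 2) w.
Proof.
move=> /leq4_sqr_odd hK hK' hw hX; move: hK hK' hw hX (cube_glue 5 t).
rewrite /wiener_bound !oddD !addbF /= -!mulnn.
move: ((t + 2) ^ 3) ((5 + t + 2) ^ 3) => b c.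
case: (odd t) => /=; clear; lia.
Qed.

(** * Minimum degree three: the case without 2-separations, and gluing *)

Section LargeDegree.

Variables (V : finType) (e : rel V).
Hypotheses (eC : symmetric e) (eI : irreflexive e).
Hypothesis sparse : forall T : {set V}, 3 <= #|T| -> narcs e T T + 8 <= 4 * #|T|.
Hypothesis trifree : forall u v w, e u v -> e v w -> ~~ e u w.
Implicit Types (S P L Q T A B : {set V}) (u v w x y z : V).

(** The first sphere has [#|nb e S u|] points, later ones at least three. Degree at least 3 allows
    an estimate linear in the degree, so that summing over [u] involves only the number of arcs. *)
Lemma transm_le_3connected S u : u \in S -> 3 <= #|nb e S u| ->
  (forall P L, separates e S P L -> 3 <= #|L|) ->
  6 * transm e S u + #|nb e S u| * #|S|.-1 <= 6 * #|S|.-1 + 2 + #|S|.-1 ^ 2.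
Proof.
move=> uS d3 conn; rewrite /transm sum_sdist.
set r := fun k => #|S :\: ball e S [set u] k|.
have r0 : r 0 = #|S|.-1 by exact: card_compl_ball0.
have r1 : r 1 = #|S| - #|nb e S u|.+1 by exact: card_compl_ball1.
have i1 : \sum_(k < #|V|) r k <= #|S|.-1 + \sum_(k < #|V|) r k.+1.
  by rewrite -r0; exact: leq_sum_shift.
have i2 : \sum_(k < #|V|) r k.+1 <= (r 1).+1 * (r 1).+2 %/ 6.
  apply: (@sum_decr3 (fun k => r k.+1)) => k.
  apply: ball_growth => //; rewrite ?sub1set //.
  by apply/set0Pn; exists u; rewrite inE.
have i3 : 6 * \sum_(k < #|V|) r k.+1 <= (r 1).+1 * (r 1).+2 by rewrite mulnC -leq_divRL.
have dS : #|nb e S u| <= #|S|.-1.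
  rewrite -(nbD1 eI uS) (cardsD1 u S) uS /=.
  by apply: subset_leq_card; apply/subsetP=> v; rewrite in_nb => /andP[].
move: i1 i3 dS d3; rewrite r1.
have S0 : 0 < #|S| by rewrite card_gt0; apply/set0Pn; exists u.
move: (\sum_(_ < _) _) (\sum_(_ < _) _) #|nb e S u| => a b d i1 i3 dS d3.
have [m Em] : exists m, #|S|.-1 = m + d by exists (#|S|.-1 - d); lia.
have E : #|S| - d.+1 = m by lia.
rewrite E in i3; rewrite Em in i1 *.
have : 3 * m <= d * m by rewrite leq_mul2r d3 orbT.
by move: i1 i3; clear; lia.
Qed.

Lemma wiener_bound_3connected S : tight e S -> 4 <= #|S| ->
  (forall u, u \in S -> 3 <= #|nb e S u|) ->
  (forall P L, separates e S P L -> 3 <= #|L|) -> wiener_bound #|S| (wsum e S).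
Proof.
move=> tS S4 deg conn.
have : 6 * wsum e S + narcs e S S * #|S|.-1 <= #|S| * (6 * #|S|.-1 + 2 + #|S|.-1 ^ 2).
  rewrite /wsum /narcs big_distrr big_distrl /= -big_split /= -sum_nat_const.
  by apply: leq_sum => u uS; apply: transm_le_3connected => //; exact: deg.
have -> : narcs e S S = 4 * #|S| - 8 by move: tS; rewrite /tight; lia.
move: (wsum _ _) S4 => w; rewrite /wiener_bound; clear; move: #|S| => n n4.
have [m ->] : exists m, n = m + 4 by exists (n - 4); lia.
rewrite (_ : 4 * (m + 4) - 8 = 4 * m + 8); last by lia.
rewrite (_ : (m + 4).-1 = m + 3); last by lia.
by case: odd; clear; lia.
Qed.

Lemma sdist_ge2 S u v : u \in S -> v \in S -> u != v -> ~~ e u v -> 2 <= sdist e S [set u] v.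
Proof.
move=> uS vS uv nuv; rewrite leqNgt; apply/negP=> lt.
have V2 : 1 < #|V|.
  have : #|[set u; v]| <= #|V| by exact: max_card.
  by rewrite cards2 uv.
have /(subsetP (ball_le e S [set u] (ltnSE lt))) : v \in ball e S [set u] (sdist e S [set u] v).
  by apply: sdist_ball; apply: leq_trans lt V2.
by rewrite ball1E // in_setU1 in_nb (negbTE nuv) andbF orbF eq_sym (negbTE uv).
Qed.

Definition sum2 (F : V -> V -> nat) A B := \sum_(u in A) \sum_(v in B) F u v.

Lemma sum2_addl F A A' B : [disjoint A & A'] -> sum2 F (A :|: A') B = sum2 F A B + sum2 F A' B.
Proof. by move=> d; rewrite /sum2 -bigU //; apply: eq_bigl => v; rewrite !inE. Qed.

Lemma sum2_addr F A B B' : [disjoint B & B'] -> sum2 F A (B :|: B') = sum2 F A B + sum2 F A B'.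
Proof.
move=> d; rewrite /sum2 -big_split /=; apply: eq_bigr => u _.
by rewrite -bigU //; apply: eq_bigl => v; rewrite !inE.
Qed.

Lemma wsum_mono S T : T \subset S ->
  sum2 (fun u v => sdist e S [set u] v) T T <= wsum e T.
Proof. by move=> TS; apply: leq_sum => u _; apply: leq_sum => v _; apply: sdist_mono. Qed.

(** Distances within a side are at least those in [S]. Pairs inside [L] belong to both sides, hence
    the extra term on the left. *)
Lemma wsum_glue S P L : separates e S P L ->
  wsum e S + sum2 (fun u v => sdist e S [set u] v) L L <=
  wsum e (P :|: L) + wsum e (S :\: (P :|: L) :|: L) +
    2 * sum2 (fun u v => sdist e S [set u] v) P (S :\: (P :|: L)).
Proof.
move=> sep; set Q := S :\: _; set D := fun u v => _.
have [_ /proper_sub QLS dQL _] : separates e S Q L by exact: separates_compl.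
case: sep => P0 /proper_sub PLS dPL _.
have dPLQ : [disjoint P :|: L & Q].
  by rewrite -setI_eq0; apply/eqP/setP=> v; rewrite !inE; case: (v \in P); case: (v \in L).
have defS : S = P :|: L :|: Q by rewrite /Q setDE setUIr setUCr setIT; apply/esym/setUidPr.
have h1 := wsum_mono PLS; have h2 := wsum_mono QLS; rewrite -/D in h1 h2.
have QP : sum2 D Q P = sum2 D P Q.
  rewrite /sum2 exchange_big /=; apply: eq_bigr => u uP; apply: eq_bigr => v vQ.
  apply: sdistC => //; first by move: vQ; rewrite in_setD => /andP[].
  by apply: (subsetP PLS); rewrite inE uP.
have -> : wsum e S = sum2 D S S by [].
have : sum2 D S S = sum2 D (P :|: L :|: Q) (P :|: L :|: Q) by rewrite -defS.
move: h1 h2; rewrite !(sum2_addl, sum2_addr) // QP; lia.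
Qed.

Section Glue.

Variables S P L : {set V}.
Hypotheses (tS : tight e S) (S4 : 4 <= #|S|) (deg3 : forall u, u \in S -> 3 <= #|nb e S u|).

Lemma nb_side Q' u : separates e S Q' L -> u \in Q' -> nb e S u = nb e (Q' :|: L) u.
Proof.
case=> _ /proper_sub/subsetP sub _ sep uQ; apply/setP=> v; rewrite !in_nb.
case uv: (e u v); rewrite ?andbF // !andbT; apply/idP/idP => [vS|/sub//].
exact: sep uQ vS uv.
Qed.

(* [Q' :|: L] spans [2 * #|Q'|] edges, while the degrees in [Q'] sum up to at least
   [3 * #|Q'|]. *)
Lemma side_narcs Q' : separates e S Q' L -> #|L| = 2 -> 2 * #|Q'| <= narcs e Q' Q' /\ 4 <= #|Q'|.
Proof.
move=> sep L2; have [tQ nL] := tight_sides eC sparse tS sep L2.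
have [_ _ cQL _ [Q0 _]] := separates_narcs eC sep.
have dQL : [disjoint Q' & L] by case: sep.
have QS u : u \in Q' -> u \in S.
  by case: sep => _ /proper_sub/subsetP sub _ _ uQ; apply: sub; rewrite inE uQ.
have h3 : 3 * #|Q'| <= narcs e Q' (Q' :|: L).
  rewrite mulnC -sum_nat_const; apply: leq_sum => u uQ.
  by rewrite -(nb_side sep uQ) deg3 // QS.
have h : 2 * #|Q'| <= narcs e Q' Q'.
  move: h3 tQ; rewrite /tight cQL L2 !(narcs_add, narcs_addr eC) // nL (narcsC eC L Q'); lia.
(* Fewer than three vertices cannot span that many edges, and three would form a triangle, against
   sparsity. *)
split=> //; have := narcs_small eI Q'; have := sparse (T := Q').
move: h Q0; case: #|Q'| => [|[|[|[|m]]]]; lia.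
Qed.

Hypotheses (sepP : separates e S P L) (L2 : #|L| = 2).
Hypothesis minP : forall P' L', #|P'| < #|P| -> separates e S P' L' -> 3 <= #|L'|.

Let Q := S :\: (P :|: L).
Let m u := sdist e (P :|: L) L u.
Let m' w := sdist e (Q :|: L) L w.
(** From the transmission bound for a point of [L] in [Q :|: L], its distance to the other point of
    [L], at least 2, is subtracted. *)
Let K := (#|Q| + 2) ^ 2 %/ 4 - 2.
Let K' := #|Q|.+1 ^ 2 %/ 4.
Let r k := #|P :\: ball e (P :|: L) L k|.

Let sepQ : separates e S Q L. Proof. exact: separates_compl. Qed.
Let dPL : [disjoint P & L]. Proof. by case: sepP. Qed.
Let dQL : [disjoint Q & L]. Proof. by case: sepQ. Qed.
Let PLS : P :|: L \subset S. Proof. by case: sepP => _ /proper_sub. Qed.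
Let QLS : Q :|: L \subset S. Proof. by case: sepQ => _ /proper_sub. Qed.
Let LS u : u \in L -> u \in S.
Proof. by move=> uL; apply: (subsetP PLS); rewrite inE uL orbT. Qed.
Let PS u : u \in P -> u \in S.
Proof. by move=> uP; apply: (subsetP PLS); rewrite inE uP. Qed.
Let LPL u : u \in L -> u \in P :|: L. Proof. by rewrite in_setU orbC => ->. Qed.
Let LQL u : u \in L -> u \in Q :|: L. Proof. by rewrite in_setU orbC => ->. Qed.
Let PPL u : u \in P -> u \in P :|: L. Proof. by rewrite inE => ->. Qed.
Let L_neq0 : L != set0. Proof. by rewrite -card_gt0 L2. Qed.

Let L_indep x y : x \in L -> y \in L -> ~~ e x y.
Proof.
move=> xL yL; have [_ /eqP] := tight_sides eC sparse tS sepP L2.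
rewrite narcsE sum_nat_eq0 => /forallP/(_ x); rewrite xL sum_nat_eq0 => /forallP/(_ y).
by rewrite yL eqb0.
Qed.

Let other x : x \in L -> exists y, [/\ y \in L, y != x & L = [set x; y]].
Proof.
move=> xL; have : #|L :\ x| == 1 by rewrite -eqSS -L2 (cardsD1 x L) xL.
case/cards1P=> y Ey; exists y; have : y \in L :\ x by rewrite Ey inE.
rewrite in_setD1 => /andP[yx yL]; split=> //.
by rewrite -(setD1K xL) Ey.
Qed.

Let LL4 : 4 <= sum2 (fun u v => sdist e S [set u] v) L L.
Proof.
have [x xL] : exists x, x \in L by apply/set0Pn.
have [y [yL yx ->]] := other xL.
rewrite /sum2 !big_setU1 ?inE 1?eq_sym //= !big_set1 !big_setU1 ?inE 1?eq_sym //= !big_set1.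
have := sdist_ge2 (LS xL) (LS yL); rewrite eq_sym yx L_indep // => /(_ isT isT).
have := sdist_ge2 (LS yL) (LS xL); rewrite yx L_indep // => /(_ isT isT).
clear; lia.
Qed.

Let tQL : tight e (Q :|: L). Proof. by have [] := tight_sides eC sparse tS sepQ L2. Qed.
Let cQL : #|Q :|: L| = #|Q| + 2.
Proof. by rewrite cardsU (disjoint_setI0 dQL) cards0 subn0 L2. Qed.
Let cPL : #|P :|: L| = #|P| + 2.
Proof. by rewrite cardsU (disjoint_setI0 dPL) cards0 subn0 L2. Qed.
Let Q4 : 4 <= #|Q|. Proof. by have [] := side_narcs sepQ L2. Qed.
Let QL4 : 4 <= #|Q :|: L|. Proof. by rewrite cQL (leq_trans Q4) // leq_addr. Qed.

Let sum_far x : x \in L -> \sum_(w in Q) sdist e (Q :|: L) [set x] w <= K.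
Proof.
move=> xL; have := transm_le eC eI sparse tQL QL4 (LQL xL).
rewrite cQL /transm; have [y [yL yx EL]] := other xL.
have -> : \sum_(w in Q :|: L) sdist e (Q :|: L) [set x] w =
    \sum_(w in Q) sdist e (Q :|: L) [set x] w + \sum_(w in L) sdist e (Q :|: L) [set x] w.
  by rewrite -bigU //; apply: eq_bigl => w; rewrite !inE.
have : 2 <= \sum_(w in L) sdist e (Q :|: L) [set x] w.
  rewrite (big_setD1 y) //=; apply: leq_trans (leq_addr _ _).
  by apply: sdist_ge2; rewrite ?LQL ?L_indep // eq_sym.
rewrite /K; clear; lia.
Qed.

Let K_le : 4 * (K + 2) <= (#|Q| + 2) ^ 2.
Proof.
rewrite /K subnK; first by rewrite mulnC leq_trunc_div.
by rewrite leq_divRL //; apply: (@leq_trans (6 ^ 2)) => //; rewrite leq_exp2r //; move: Q4; lia.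
Qed.

Let K'_le : 4 * K' <= #|Q|.+1 ^ 2. Proof. by rewrite mulnC leq_trunc_div. Qed.

(** Minimality concerns [P]; in [Q] the spheres around [L] are only known to have two points
    each. *)
Let sum_m' : \sum_(w in Q) m' w <= K'.
Proof.
rewrite /m' sum_sdist /K'.
have E : #|Q :\: ball e (Q :|: L) L 0| = #|Q|.
  by congr #|pred_of_set _|; apply/setDidPl; rewrite disjoint_sym disjoint_sym.
rewrite -E; apply: (@sum_decr2 (fun k => #|Q :\: ball e (Q :|: L) L k|)) => k.
have sep2 P' L' := tight_separates (P := P') (L := L') eC eI sparse tS S4.
apply: (@ball_side_growth _ e eC 2 S Q L k sepQ) => [P' L' /sep2|P' L' _ /sep2//].
exact: ltnW.
Qed.

Let cross_via u w x : u \in P -> w \in Q -> x \in L ->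
  sdist e S [set u] w <= sdist e (P :|: L) [set x] u + sdist e (Q :|: L) [set x] w.
Proof.
move=> uP wQ xL; apply: leq_trans (sdist_trans _ _ _ (LS xL)) _; apply: leq_add.
  by rewrite (sdistC eC (PS uP) (LS xL)); apply: sdist_mono.
exact: sdist_mono.
Qed.

Let cross_any u : u \in P -> \sum_(w in Q) sdist e S [set u] w <= #|Q| * m u + K.
Proof.
move=> uP; have [x xL xu] := sdist_single e (P :|: L) u L_neq0.
apply: leq_trans (leq_add (leqnn _) (sum_far xL)); rewrite -sum_nat_const -big_split /=.
apply: leq_sum => w wQ; apply: leq_trans (cross_via uP wQ xL) _.
by rewrite leq_add2r.
Qed.

Let cross_both u : u \in P -> (forall x, x \in L -> sdist e (P :|: L) [set x] u <= m u) ->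
  \sum_(w in Q) sdist e S [set u] w <= #|Q| * m u + K'.
Proof.
move=> uP both; apply: leq_trans (leq_add (leqnn _) sum_m').
rewrite -sum_nat_const -big_split /=; apply: leq_sum => w wQ.
have [x xL xw] := sdist_single e (Q :|: L) w L_neq0.
by apply: leq_trans (cross_via uP wQ xL) _; apply: leq_add; rewrite ?both.
Qed.

Let r0 : r 0 = #|P|.
Proof. by congr #|pred_of_set _|; apply/setDidPl. Qed.

Let r_decr k : r k.+1 <= r k - 3.
Proof.
apply: (@ball_side_growth _ e eC 3 S P L k sepP _ minP) => P' L' h.
exact: ltnW (tight_separates eC eI sparse tS S4 h).
Qed.

Let sum_m : \sum_(u in P) m u = \sum_(k < #|V|) r k. Proof. exact: sum_sdist. Qed.

Let sum_m_le : \sum_(u in P) m u <= #|P|.+1 * #|P|.+2 %/ 6.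
Proof. by rewrite sum_m -r0; apply: sum_decr3. Qed.

Let sum_m_le2 : \sum_(u in P) m u <= r 0 + (r 1 + (r 2).+1 * (r 2).+2 %/ 6).
Proof.
rewrite sum_m; apply: leq_trans (leq_sum_shift _ _) _; rewrite leq_add2l.
apply: leq_trans (leq_sum_shift (fun k => r k.+1) _) _; rewrite leq_add2l.
exact: (@sum_decr3 (fun k => r k.+2)).
Qed.

Let nb_far z : z \in P :\: ball e (P :|: L) L 1 -> nb e S z \subset P :\ z.
Proof.
rewrite in_setD => /andP[zB zP]; apply/subsetP=> w wz.
rewrite in_setD1; apply/andP; split.
  by move: wz; rewrite in_nb => /andP[_]; apply: contraTneq => ->; rewrite eI.
move: wz; rewrite (nb_side sepP zP) in_nb => /andP[wPL zw].
move: (wPL); rewrite inE => /orP[//|wL]; case/negP: zB.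
by apply: (@ball_step _ e (P :|: L) L 0 w) => //; rewrite ?PPL // eC.
Qed.

(** A vertex [z] of [P] with no neighbour in [L] would be adjacent to the other three, which are
    then independent; [P] would span three edges instead of at least four. *)
Let far4 : #|P| = 4 -> r 1 = 0.
Proof.
move=> P4; apply/eqP; rewrite cards_eq0 -subset0; apply/subsetP=> z zF.
have zP : z \in P by move: zF; rewrite in_setD => /andP[].
have c3 : #|P :\ z| = 3 by apply/eqP; rewrite -eqSS -P4 (cardsD1 z P) zP.
have nbz : nb e S z = P :\ z.
  by apply/eqP; rewrite eqEcard nb_far // c3 deg3 ?PS.
have [n8 _] := side_narcs sepP L2; move: n8.
rewrite (narcsD1 eC eI zP) P4.
have -> : narcs e (P :\ z) (P :\ z) = 0.
  apply: narcs_eq0 => u v; rewrite -nbz !in_nb => /andP[_ zu] /andP[_ zv].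
  by apply: (trifree _ zv); rewrite eC.
have : #|nb e P z| <= 3.
  rewrite -c3; apply: subset_leq_card; apply/subsetP=> v; rewrite -nbz !in_nb.
  by move=> /andP[/PS-> ->].
clear; lia.
Qed.

(** The two vertices of [P] without a neighbour in [L] are not adjacent, so [z] is joined to the
    other three. Each [x] in [L] has a neighbour among these, which gives a path of length 2 from
    [x] to [z]. *)
Let far5 z : #|P| = 5 -> r 1 = 2 -> z \in P :\: ball e (P :|: L) L 1 ->
  forall x, x \in L -> sdist e (P :|: L) [set x] z <= m z.
Proof.
move=> P5 rE zF x xL; set F := P :\: ball e (P :|: L) L 1 in zF.
have zP : z \in P by move: zF; rewrite in_setD => /andP[].
have cF : #|F| = 2 by [].
have cPF : #|P :\: F| = 3.
  by rewrite cardsD (setIidPr (subsetDl _ _)) cF P5.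
have mz : 2 <= m z.
  rewrite leqNgt; apply/negP=> lt; move: zF; rewrite in_setD => /andP[/negP[]].
  apply: (subsetP (ball_le e (P :|: L) L (ltnSE lt))); apply: sdist_ball.
  by apply: leq_trans lt _; rewrite -L2 max_card.
apply: leq_trans mz; apply: sdist_le.
have nb_diff y1 y2 : y1 \in F -> y2 \in F -> e y1 y2 -> False.
  (* Otherwise [y1] and [y2] have two neighbours each in the three-element set
     [P :\: F], hence a common one. *)
  move=> y1F y2F y12.
  have two y : y \in F -> 2 <= #|nb e S y :\: F|.
    move=> yF; have yP : y \in P by move: yF; rewrite in_setD => /andP[].
    have h : nb e S y :&: F \subset F :\ y.
      apply/subsetP=> w; rewrite in_setI in_setD1 in_nb => /andP[/andP[_ yw] ->].
      by rewrite andbT; apply: contraTneq yw => ->; rewrite eI.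
    have := subset_leq_card h; have := deg3 (PS yP).
    rewrite -(cardsID F (nb e S y)); have := cardsD1 y F; rewrite yF cF.
    by clear; lia.
  have sub y : y \in F -> nb e S y :\: F \subset P :\: F.
    by move=> yF; apply/setSD/(subset_trans (nb_far yF))/subsetDl.
  have : #|(nb e S y1 :\: F) :&: (nb e S y2 :\: F)| = 0.
    apply/eqP; rewrite cards_eq0 -subset0; apply/subsetP=> w.
    rewrite in_setI !in_setD !in_nb => /andP[/andP[_ /andP[_ w1]] /andP[_ /andP[_ w2]]].
    by have := trifree y12 w2; rewrite w1.
  have : #|(nb e S y1 :\: F) :|: (nb e S y2 :\: F)| <= 3.
    by rewrite -cPF; apply: subset_leq_card; rewrite subUset !sub.
  by rewrite cardsU; have := two _ y1F; have := two _ y2F; clear; lia.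
have nbz : nb e S z = P :\: F.
  apply/eqP; rewrite eqEcard cPF deg3 ?PS // andbT; apply/subsetP=> w wz.
  have := subsetP (nb_far zF) _ wz; rewrite in_setD1 in_setD => /andP[_ ->]; rewrite andbT.
  by apply/negP=> wF; apply: (nb_diff z w) => //; move: wz; rewrite in_nb => /andP[].
(* Otherwise [L :\ x] would be a separator with a single point. *)
have [p pP xp] : exists2 p, p \in P & e x p.
  have [/exists_inP//|] := boolP [exists p in P, e x p].
  rewrite negb_exists_in => /forall_inP no.
  suff : separates e S P (L :\ x).
    move/(tight_separates eC eI sparse tS S4).
    by have := cardsD1 x L; rewrite xL L2; clear; lia.
  case: sepP => P0 PLS' _ sep; split=> //.
  - by apply: sub_proper_trans PLS'; apply/setUS/subsetDl.
  - by apply: disjointWr dPL; exact: subsetDl.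
  move=> u v uP vS uv; have := sep u v uP vS uv; rewrite !in_setU in_setD1.
  case: (v \in P) => //= ->; rewrite andbT; apply: contraTneq uv => ->.
  by rewrite eC; exact: no.
have pB : p \in ball e (P :|: L) L 1.
  by apply: (@ball_step _ e (P :|: L) L 0 x) => //; exact: PPL.
have pF : p \in nb e S z by rewrite nbz !in_setD pB pP.
have pz : e p z by move: pF; rewrite in_nb eC => /andP[].
apply: (ball_step (u := p)) (PPL zP) pz.
by rewrite ball1E ?LPL // in_setU1 in_nb PPL // xp orbT.
Qed.

(* A vertex of [P] reaches [Q] through the nearest point of [L], at a total cost of at most
   [K] beyond [L]; if it is equidistant from both points of [L], the cost is only [K'].
   The refinement is needed for [#|P| = 5], with a first sphere of three points. *)
Lemma wiener_bound_2separated :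
  wiener_bound #|P :|: L| (wsum e (P :|: L)) -> wiener_bound #|Q :|: L| (wsum e (Q :|: L)) ->
  wiener_bound #|S| (wsum e S).
Proof.
rewrite cPL cQL => bA bB.
have -> : #|S| = #|P| + #|Q| + 2.
  by have [_ h h1 h2 _] := separates_narcs eC sepP; move: h; rewrite cPL -/Q cQL L2; clear; lia.
have hw := leq_trans (leq_add (leqnn (wsum e S)) LL4) (wsum_glue sepP); rewrite -/Q in hw.
set X := sum2 _ P Q in hw.
have X1 : X <= #|Q| * \sum_(u in P) m u + #|P| * K.
  rewrite big_distrr /= -sum_nat_const -big_split /=; apply: leq_sum => u uP.
  exact: cross_any.
have [_ P4] := side_narcs sepP L2.
have [s4|n4] := eqVneq #|P| 4.
  apply: wiener_bound_glue K_le hw X1 bA bB; constructor 1; split=> //.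
  have := sum_m_le2; have := r_decr 1; rewrite r0 far4 // s4 leqn0 => /eqP->.
  by [].
have [s5|n5] := eqVneq #|P| 5; last first.
  apply: wiener_bound_glue K_le hw X1 bA bB; constructor 3; split; last exact: sum_m_le.
  by move: P4 n4 n5; clear; lia.
have r1 : r 1 <= 2 by have := r_decr 0; rewrite r0 s5.
have r2 : r 2 = 0 by apply/eqP; rewrite -leqn0; apply: leq_trans (r_decr 1) _; move: r1; clear; lia.
have hM : \sum_(u in P) m u <= 5 + r 1.
  by have := sum_m_le2; rewrite r0 r2 s5 (_ : 1 * 2 %/ 6 = 0) // addn0.
have [r12|r12] := eqVneq (r 1) 2; last first.
  apply: wiener_bound_glue K_le hw X1 bA bB; constructor 2; split=> //.
  by apply: leq_trans hM _; move: r1 r12; clear; lia.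
(* Here the distances to [L] may add up to 7; the two vertices of [F] compensate by costing only
   [K']. *)
set F := P :\: ball e (P :|: L) L 1.
have cF : #|F| = 2 by [].
have PF : P :&: F = F by apply/setIidPr/subsetDl.
have cPF : #|P :\: F| = 3 by rewrite cardsD PF s5 cF.
rewrite s5 in bA *; apply: wiener_bound_glue5 K_le K'_le hw _ bA bB.
have -> : X = sum2 (fun u v => sdist e S [set u] v) F Q +
    sum2 (fun u v => sdist e S [set u] v) (P :\: F) Q.
  by rewrite /X /sum2 (big_setID F) PF.
have hF : sum2 (fun u v => sdist e S [set u] v) F Q <= #|Q| * \sum_(u in F) m u + 2 * K'.
  rewrite -cF big_distrr /= -sum_nat_const -big_split /=; apply: leq_sum => u uF.
  apply: cross_both; first by move: uF; rewrite in_setD => /andP[].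
  exact: far5.
have hPF : sum2 (fun u v => sdist e S [set u] v) (P :\: F) Q <=
    #|Q| * \sum_(u in P :\: F) m u + 3 * K.
  rewrite -cPF big_distrr /= -sum_nat_const -big_split /=; apply: leq_sum => u uF.
  by apply: cross_any; move: uF; rewrite in_setD => /andP[].
have : \sum_(u in F) m u + \sum_(u in P :\: F) m u <= 7.
  by move: hM; rewrite r12 (big_setID F) PF.
move=> /(leq_mul (leqnn #|Q|)); rewrite mulnDr; move: hF hPF; clear; lia.
Qed.

End Glue.

(** Boolean form, from which a 2-separation with minimal [#|P|] can be chosen. *)
Definition separatesb S P L :=
  [&& P != set0, P :|: L \proper S, [disjoint P & L] &
      [forall u in P, forall v in S, e u v ==> (v \in P :|: L)]].

Lemma separatesP S P L : reflect (separates e S P L) (separatesb S P L).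
Proof.
apply: (iffP and4P) => -[h1 h2 h3 h4]; split=> //.
  by move=> u v uP vS; move/forall_inP/(_ u uP)/forall_inP/(_ v vS)/implyP: h4.
by apply/forall_inP=> u uP; apply/forall_inP=> v vS; apply/implyP; exact: h4.
Qed.

Theorem wiener_bound_tight S : tight e S -> 3 <= #|S| -> wiener_bound #|S| (wsum e S).
Proof.
have [n] := ubnP #|S|; elim: n S => // n IHn S leS tS S3.
have {leS}IH T : #|T| < #|S| -> 3 <= #|T| -> tight e T -> wiener_bound #|T| (wsum e T).
  by move=> ltT T3 tT; apply: IHn => //; apply: leq_trans ltT _; rewrite -ltnS.
have [S4|le3] := ltnP 3 #|S|; last first.
  by apply: wiener_bound3 => //; apply/eqP; rewrite eqn_leq le3.
have [/exists_inP[v vS /eqP d2]|] := boolP [exists v in S, #|nb e S v| == 2].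
  have [oS|eS] := boolP (odd #|S|); first exact: (wiener_bound_odd eC eI sparse trifree tS S4 oS vS d2).
  apply: (wiener_bound_even eC eI sparse tS S4 eS vS d2).
  have c : #|S :\ v| = #|S|.-1 by rewrite (cardsD1 v S) vS.
  by rewrite -c; apply: IH; rewrite ?c; [lia | lia | exact: tight_del].
rewrite negb_exists_in => /forall_inP no2.
have deg3 u : u \in S -> 3 <= #|nb e S u|.
  by move=> uS; rewrite ltn_neqAle eq_sym no2 //; exact: (tight_deg eC eI sparse).
pose cut2 (p : {set V} * {set V}) := separatesb S p.1 p.2 && (#|p.2| == 2).
have [/existsP[p0 cut0]|/existsPn no] := boolP [exists p, cut2 p]; last first.
  apply: wiener_bound_3connected => // P L sep; rewrite ltn_neqAle eq_sym.
  rewrite (tight_separates eC eI sparse tS S4 sep) andbT.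
  by have := no (P, L); rewrite /cut2 /=; move/separatesP: sep => ->.
have [[P L] /andP[/= /separatesP sep /eqP L2] minP] := arg_minnP (fun p : {set V} * {set V} => #|p.1|) cut0.
have sub P' : separates e S P' L -> wiener_bound #|P' :|: L| (wsum e (P' :|: L)).
  move=> sep'; have [tP _] := tight_sides eC sparse tS sep' L2.
  have [_ _ cP _ [P0 _]] := separates_narcs eC sep'.
  apply: IH => //; last by rewrite cP L2; move: P0; clear; lia.
  by case: sep' => _ /proper_card.
apply: (wiener_bound_2separated tS S4 deg3 sep L2) => [P' L' ltP sep'||]; [|exact: sub|exact/sub/separates_compl].
(* A separator of two points would contradict the choice of [P]. *)
rewrite ltn_neqAle eq_sym (tight_separates eC eI sparse tS S4 sep') andbT.
apply/negP=> /eqP L'2; have := minP (P', L'); rewrite /cut2 /= L'2 eqxx andbT.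
by move/separatesP: sep' => -> /(_ isT); rewrite leqNgt ltP.
Qed.

End LargeDegree.

(** * Quadrangulations are sparse and triangle-free *)

Lemma cards3 (U : finType) (a b c : U) : uniq [:: a; b; c] -> #|[set a; b; c]| = 3.
Proof.
rewrite /= !inE negb_or andbT => /andP[/andP[ab ac] bc].
by rewrite setUC cardsU1 cards2 !inE ab (eq_sym c a) (negbTE ac) (eq_sym c b) (negbTE bc).
Qed.

Section Planar.

Variables (V : finType) (e : rel V) (rot : V -> V -> V).
Hypotheses (eC : symmetric e) (eI : irreflexive e) (conn : connected_graph e).
Hypotheses (rotS : rotation_system e rot) (sph : spherical e rot).
Hypothesis quad : faces_are_4cycles e rot.
Implicit Types (T : {set V}) (C : {set V * V}) (p q : V * V) (u v w : V).

Local Notation D := (darts e).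
Local Notation phi := (face_succ rot).

Definition rev p := (p.2, p.1).
Definition inside T p := (p.1 \in T) && (p.2 \in T).

Lemma dartE u v : ((u, v) \in D) = e u v. Proof. by rewrite inE. Qed.

Lemma dart_rev p : (rev p \in D) = (p \in D).
Proof. by case: p => u v; rewrite !inE /= eC. Qed.

Lemma dart_phi p : p \in D -> phi p \in D.
Proof.
case: p => u v; rewrite !inE /= eC => vu.
by have [h _ _] := rotS v; exact: h.
Qed.

Lemma phi4 p : p \in D -> iter 4 phi p = p.
Proof. by case/quad. Qed.

Lemma face_ofE p : p \in D -> face_of rot p = [set iter i phi p | i : 'I_4].
Proof.
move=> pD; apply/setP=> q; rewrite inE; apply/idP/imsetP => [|[i _ ->]]; last exact: fconnect_iter.
move=> /iter_findex <-; move: (findex _ _ _) => n.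
exists (Ordinal (ltn_pmod n (isT : 0 < 4))) => //=.
rewrite {1}(divn_eq n 4) addnC iterD; congr (iter _ _ _).
elim: (n %/ 4) => // m IH; by rewrite mulSn addnC iterD phi4.
Qed.

Lemma card_face p : p \in D -> #|face_of rot p| = 4.
Proof.
move=> pD; rewrite face_ofE // card_imset ?card_ord // => i j eqij.
have [_ un] := quad pD; apply/val_inj/eqP.
have sz (k : 'I_4) : k < size [seq (iter i phi p).1 | i <- iota 0 4].
  by rewrite size_map size_iota.
rewrite -(nth_uniq p.1 (sz i) (sz j) un).
by rewrite !(nth_map 0) ?size_iota // !nth_iota // !add0n eqij.
Qed.

Lemma face_closed C p : p \in C -> (forall q, q \in C -> phi q \in C) -> face_of rot p \subset C.
Proof.
move=> pC h; apply/subsetP=> q; rewrite inE => /iter_findex <-.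
by elim: (findex _ _ _) => //= n; exact: h.
Qed.

Lemma in_face p q : p \in D -> q \in D -> (q \in face_of rot p) = (face_of rot q == face_of rot p).
Proof.
move=> pD qD; apply/idP/eqP => [|<-]; last by rewrite inE connect0.
rewrite inE => pq; have qp : fconnect phi q p.
  move: pq => /iter_findex; move: (findex _ _ _) => n <-.
  apply: connect_trans (fconnect_iter phi (3 * n) _) _.
  rewrite -iterD (_ : 3 * n + n = n * 4); last by lia.
  suff -> : iter (n * 4) phi p = p by [].
  by elim: n => // m IH; rewrite mulSn addnC iterD phi4.
apply/setP=> r; rewrite !inE; apply/idP/idP; exact: connect_trans.
Qed.

Lemma card_phi_closed C : C \subset D -> (forall p, p \in C -> phi p \in C) ->
  #|C| = #|[set face_of rot p | p in C]| * 4.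
Proof.
move=> /subsetP CD cl; rewrite -sum1_card (partition_big_imset (face_of rot)) /=.
rewrite -sum_nat_const; apply: eq_bigr => _ /imsetP[p pC ->].
rewrite sum1_card -(card_face (CD _ pC)); apply: eq_card => q; rewrite unfold_in /=.
apply/andP/idP => [[qC /eqP <-]|qp]; first by rewrite inE connect0.
have qC := subsetP (face_closed pC cl) _ qp.
by rewrite qC -in_face ?CD.
Qed.

Lemma card_darts : #|D| + 8 = 4 * #|V|.
Proof.
have := card_phi_closed (subxx D) dart_phi; rewrite -/(nfaces e rot).
by move: sph; rewrite /spherical; lia.
Qed.

(* Regions cut out by the edges inside [T]: faces are merged across all other edges. *)
Definition merge T : rel (V * V) := fun p q =>
  [&& p \in D, q \in D &
      [|| q == phi p, p == phi q | (q == rev p) && ~~ inside T p]].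

Definition region T p : {set V * V} := [set q | connect (merge T) p q].

Definition regions T := [set region T p | p in D].

Lemma merge_sym T : symmetric (merge T).
Proof.
move=> p q; rewrite /merge andbCA; congr [&& _, _ & _].
rewrite orbCA; congr [|| _, _ | _]; case: p q => [a b] [c d]; rewrite /rev /inside /=.
by apply/andP/andP => -[/eqP[-> ->]]; rewrite andbC => h; rewrite eqxx.
Qed.

Lemma region_refl T p : p \in region T p. Proof. by rewrite inE connect0. Qed.

Lemma region_eq T p q : q \in region T p -> region T q = region T p.
Proof.
rewrite inE => pq; apply/setP=> r; rewrite !inE; apply/esym/(same_connect _ pq).
exact/sym_connect_sym/merge_sym.
Qed.

Lemma region_closed T p C : p \in C ->
  (forall q r, q \in C -> merge T q r -> r \in C) -> region T p \subset C.
Proof.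
move=> pC cl; apply/subsetP=> q; rewrite inE => /connectP[s + ->].
by elim: s p pC => //= a s IH p pC /andP[pa]; apply: IH; exact: cl pC pa.
Qed.

Lemma region_merge T p q r : q \in region T p -> merge T q r -> r \in region T p.
Proof. by rewrite !inE => pq qr; apply: connect_trans pq (connect1 qr). Qed.

Lemma region_sub T p : p \in D -> region T p \subset D.
Proof. by move=> pD; apply: region_closed => // q r _ /and3P[]. Qed.

Lemma region_phi T p q : p \in D -> q \in region T p -> phi q \in region T p.
Proof.
move=> pD qp; have qD := subsetP (region_sub T pD) _ qp.
by apply: region_merge qp _; rewrite /merge qD dart_phi //= eqxx.
Qed.

Lemma region_rev T p q : p \in D -> q \in region T p -> ~~ inside T q -> rev q \in region T p.
Proof.
move=> pD qp qT; have qD := subsetP (region_sub T pD) _ qp.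
by apply: region_merge qp _; rewrite /merge qD dart_rev qD eqxx qT !orbT.
Qed.

(** With all vertices kept, no edge is crossed; a step back along [phi] is three steps forward. *)
Lemma regionsT : regions [set: V] = [set face_of rot p | p in D].
Proof.
apply: eq_in_imset => p pD; apply/eqP; rewrite eqEsubset; apply/andP; split.
  apply: region_closed => [|q r qp /and3P[qD rD]]; first by rewrite inE connect0.
  rewrite /inside !inE andbF orbF => /orP[]/eqP E.
    by rewrite E; move: qp; rewrite !inE => h; apply: connect_trans h (fconnect1 _ _).
  have -> : r = iter 3 phi q by rewrite E -iterSr phi4.
  by move: qp; rewrite !inE => h; apply: connect_trans h (fconnect_iter _ _ _).
by apply: face_closed (region_refl _ _) _ => q; exact: region_phi.
Qed.

Lemma sum_regions T (G : V * V -> nat) :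
  \sum_(p in D) G p = \sum_(C in regions T) \sum_(p in C) G p.
Proof.
rewrite (partition_big_imset (region T)) /=; apply: eq_bigr => _ /imsetP[p pD ->].
apply: eq_bigl => q; apply/andP/idP => [[_ /eqP <-]|qp]; first exact: region_refl.
by rewrite (region_eq qp) eqxx (subsetP (region_sub T pD)).
Qed.

(** Turning around [v] past an edge whose other end is outside [T] stays in the region, so every
    dart from [v] shares its region with a dart from [v] into [T]. *)
Lemma out_regions T v w : e v w -> (exists a, a \in nb e T v) -> v \notin T ->
  region (v |: T) (v, w) \in [set region (v |: T) (v, a) | a in nb e T v].
Proof.
move=> vw [a av] vT; move: (av); rewrite in_nb => /andP[aT va].
have [hS _ hc] := rotS v; have /iter_findex := hc w a vw va.
move: (findex _ _ _) => n; elim: n w vw => [|n IH] w vw.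
  by move=> /= ->; exact: imset_f.
rewrite iterSr => /(IH _ (hS _ vw)).
have [wT|wT] := boolP (w \in T); first by move=> _; apply: imset_f; rewrite in_nb wT.
suff -> : region (v |: T) (v, rot v w) = region (v |: T) (v, w) by [].
apply: region_eq; have vwD : (v, w) \in D by rewrite dartE.
apply: (@region_phi _ _ (w, v)) => //; apply: (@region_rev _ _ (v, w)) => //.
  exact: region_refl.
rewrite /inside /= !inE (negbTE wT) orbF negb_and; apply/orP; right.
by apply: contraTneq vw => ->; rewrite eI.
Qed.

(* Deleting the vertex [v] merges the at most [#|nb e T v|] regions around it into one. *)
Lemma card_regions_step T v : v \notin T -> (exists a, a \in nb e T v) ->
  #|regions (v |: T)| < #|regions T| + #|nb e T v|.
Proof.
move=> vT ex; have [a av] := ex; move: (av); rewrite in_nb => /andP[aT va].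
set T' := v |: T; set X := [set region T' (v, w) | w in nb e T v].
have X_le : #|X| <= #|nb e T v| by exact: leq_imset_card.
have inX w : e v w -> region T' (v, w) \in X by move=> vw; exact: out_regions.
(* Regions outside [X] do not change: a newly allowed crossing uses an edge at [v], whose darts lie
   in members of [X]. *)
have same p : p \in D -> region T' p \notin X -> region T p = region T' p.
  move=> pD pX; apply/eqP; rewrite eqEsubset; apply/andP; split; last first.
    apply: region_closed (region_refl _ _) _ => q r qp qr; apply: region_merge qp _.
    move: qr; rewrite /merge => /and3P[-> -> /or3P[->//|->|/andP[-> h]]]; rewrite ?orbT //=.
    suff -> : ~~ inside T q by rewrite !orbT.
    apply: contra h => /andP[h1 h2]; by rewrite /inside !inE h1 h2 !orbT.
  apply: region_closed (region_refl _ _) _ => q r qp /and3P[qD rD].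
  case/or3P => [qr|qr|/andP[qr qT]].
  - by apply: region_merge qp _; rewrite /merge qD rD qr.
  - by apply: region_merge qp _; rewrite /merge qD rD qr orbT.
  have [qT'|qT'] := boolP (inside T' q); last by rewrite (eqP qr); exact: region_rev.
  case/negP: pX; rewrite -(region_eq qp).
  case: q qp qD qT qT' {qr} => b c qp qD; rewrite /inside /= !inE.
  move: (qD); rewrite dartE => bc.
  have [bv _ _|nbv] := eqVneq b v; first by rewrite bv in bc *; exact: inX.
  have [cv _ _|nc] := eqVneq c v; last by move=> /= /negbTE->.
  rewrite cv in qD bc qp *.
  have <- : region T' (v, rot v b) = region T' (b, v).
    by apply: region_eq; exact: (region_phi qD (region_refl _ _)).
  by apply: inX; have := dart_phi qD; rewrite dartE.
have sub : regions T' :\: X \subset regions T.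
  apply/subsetP=> C; rewrite inE => /andP[CX /imsetP[p pD E]].
  by rewrite E -same -?E //; exact: imset_f.
have vaD : (v, a) \in D by rewrite dartE.
have new : region T (v, a) \in regions T by exact: imset_f.
have fresh : region T (v, a) \notin regions T' :\: X.
  apply/negP; rewrite inE => /andP[CX /imsetP[p pD E]]; case/negP: CX.
  by rewrite E -(@region_eq T' p (v, a)) -?E ?region_refl // inX.
have : #|region T (v, a) |: (regions T' :\: X)| <= #|regions T|.
  by apply: subset_leq_card; rewrite subUset sub1set new.
rewrite cardsU1 fresh add1n => h.
have := cardsID X (regions T'); have := subset_leq_card (subsetIr (regions T') X).
move: h X_le; clear; lia.
Qed.

Lemma exists_boundary T : T != set0 -> T != setT ->
  exists v, v \notin T /\ exists a, a \in nb e T v.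
Proof.
case/set0Pn=> a aT neT; have [b bT] : exists b, b \notin T.
  by apply/existsP; rewrite -negb_forall; apply: contra neT => /forallP h; apply/eqP/setP=> x; rewrite h inE.
have /connectP[s + Eb] := conn a b; rewrite Eb in bT.
elim: s a aT bT {Eb} => [|c s IH] a aT; first by rewrite /= aT.
rewrite /= => bT /andP[ac pth]; have [cT|cT] := boolP (c \in T); first exact: IH cT bT pth.
by exists c; split=> //; exists a; rewrite in_nb aT eC.
Qed.

(* Euler's inequality for the subgraph induced by [T], obtained by deleting the other
   vertices one at a time. *)
Lemma euler_sub T : T != set0 -> 4 + narcs e T T <= 2 * (#|T| + #|regions T|).
Proof.
have [n] := ubnP (#|V| - #|T|); elim: n T => // n IH T ltn T0.
have [->|neT] := eqVneq T setT.
  rewrite regionsT cardsT -/(nfaces e rot).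
  suff -> : narcs e setT setT = #|D| by move: sph; rewrite /spherical; lia.
  rewrite narcsE pair_big_dep /= -sum1_card big_mkcond /= [RHS]big_mkcond /=.
  by apply: eq_bigr => -[u v] _; rewrite !inE /=; case: (e u v).
have [v [vT ex]] := exists_boundary T0 neT.
have lt := card_regions_step vT ex.
have cT : #|v |: T| = #|T|.+1 by rewrite cardsU1 vT.
have := IH (v |: T); rewrite cT (narcsD1 eC eI (setU11 v T)) setU1K //.
have -> : nb e (v |: T) v = nb e T v.
  by apply/setP=> w; rewrite !in_nb !inE; case: eqP => //= ->; rewrite eI andbF.
have h1 : v |: T != set0 by apply/set0Pn; exists v; rewrite setU11.
have h2 : #|T| < #|V|.
  by rewrite -cardsT; apply: proper_card; rewrite properEneq neT subsetT.
move=> /(_ _ h1) h3; have {}h3 := h3 ltac:(lia).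
by move: h3 lt; clear; lia.
Qed.

Definition boundary C := [set p in C | rev p \notin C].

Lemma in_boundary C p : (p \in boundary C) = (p \in C) && (rev p \notin C).
Proof. by rewrite inE. Qed.

(** Closure under [phi] and reversal gives closure under rotation at each vertex, so connectedness
    would make [C] all of [D]. *)
Lemma boundary_neq0 C : C \subset D -> C != set0 -> C != D ->
  (forall p, p \in C -> phi p \in C) -> boundary C != set0.
Proof.
move=> /subsetP CD /set0Pn[[u w] uwC] neC cl; apply: contra neC => /eqP b0.
have clr p : p \in C -> rev p \in C.
  by move=> pC; have := in_set0 p; rewrite -b0 inE pC /= => /negbFE.
have around v x y : (v, x) \in C -> e v y -> (v, y) \in C.
  move=> vx vy; have [_ _ hc] := rotS v; have := CD _ vx; rewrite dartE => evx.
  have /iter_findex <- := hc x y evx vy.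
  elim: (findex _ _ _) => //= n IH; exact: (cl _ (clr _ IH)).
have all x : exists y, (x, y) \in C.
  have /connectP[s + ->] := conn u x; have : exists y, (u, y) \in C by exists w.
  elim: s u {uwC} => //= a s IH u [y uyC] /andP[ua]; apply: IH; exists u.
  exact: clr (around _ _ _ uyC ua).
apply/eqP/setP=> -[x y]; apply/idP/idP => [/CD//|]; rewrite dartE => xy.
by have [z xz] := all x; exact: around xz xy.
Qed.

(** Rotating around [v] from the successor of [(u, v)] must leave [C], at the latest at [(v, u)];
    the last dart before that is on the boundary. *)
Lemma boundary_next C u v : C \subset D -> (forall p, p \in C -> phi p \in C) ->
  (u, v) \in boundary C -> exists w, (v, w) \in boundary C.
Proof.
move=> /subsetP CD cl; rewrite inE => /andP[uvC vuC].
have [hS _ hc] := rotS v; have := CD _ uvC; rewrite dartE eC => evu.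
have := cl _ uvC; rewrite /face_succ /= => start.
have /iter_findex := hc _ _ (hS _ evu) evu.
move: (findex _ _ _) => n; move: (rot v u) start; elim: n => [|n IH] x xC.
  by move=> /= xu; rewrite -xu /rev xC in vuC.
rewrite iterSr => hn; have [nxC|nxC] := boolP ((v, rot v x) \in C); first exact: IH nxC hn.
exists x; rewrite inE xC; apply: contra nxC => h; exact: (cl _ h).
Qed.

Lemma boundary_inside T p : p \in D -> boundary (region T p) \subset [set q | inside T q].
Proof.
move=> pD; apply/subsetP=> q; rewrite inE => /andP[qp nq]; rewrite inE.
by apply: contraR nq => h; apply: region_rev.
Qed.

Lemma region_boundary T p : p \in D -> 1 < #|regions T| ->
  exists u v w z, [/\ (u, v) \in boundary (region T p), (v, w) \in boundary (region T p),
    (w, z) \in boundary (region T p), uniq [:: u; v; w] & [&& z != v, z != w & e w z]].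
Proof.
move=> pD F2; set C := region T p.
have CD : C \subset D by exact: region_sub.
have cl q : q \in C -> phi q \in C by exact: region_phi.
have neC : C != D.
  apply: contraTneq F2 => CE; rewrite -leqNgt.
  suff -> : regions T = [set C] by rewrite cards1.
  apply/setP=> X; rewrite !inE; apply/imsetP/eqP => [[q qD ->]|->]; last by exists p.
  by apply: region_eq; rewrite -/C CE.
have C0 : C != set0 by apply/set0Pn; exists p; exact: region_refl.
have /set0Pn[[u v] uv] := boundary_neq0 CD C0 neC cl.
have [w vw] := boundary_next CD cl uv; have [z wz] := boundary_next CD cl vw.
have edge a b : (a, b) \in boundary C -> e a b.
  by rewrite inE => /andP[/(subsetP CD)]; rewrite dartE.
have neq a b : (a, b) \in boundary C -> a != b.
  by move/edge; apply: contraTneq => ->; rewrite eI.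
have nback a b c : (a, b) \in boundary C -> (b, c) \in boundary C -> c != a.
  by rewrite !inE => /andP[_ h] /andP[bc _]; apply: contraNneq h => <-.
exists u, v, w, z; split=> //=.
  by rewrite !inE negb_or (neq _ _ uv) (neq _ _ vw) eq_sym (nback _ _ _ uv vw).
by rewrite (nback _ _ _ vw wz) eq_sym (neq _ _ wz) (edge _ _ wz).
Qed.

(** Reversal pairs up the darts, without fixed points as there are no loops. *)
Lemma even_rev_closed C : C \subset D -> (forall p, p \in C -> rev p \in C) -> ~~ odd #|C|.
Proof.
move=> /subsetP CD cl; pose up p := enum_rank p.1 < enum_rank p.2.
have -> : #|C| = #|[set p in C | up p]| + #|[set p in C | up p]|.
  rewrite -{1}(cardsID [set p | up p] C); congr (_ + _).
    by apply: eq_card => p; rewrite !inE.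
  have <- : #|rev @: [set p in C | up p]| = #|[set p in C | up p]|.
    by apply: card_in_imset => -[a b] [c d] _ _ [-> ->].
  apply: eq_card => p; rewrite !inE; apply/andP/imsetP => [[pup pC]|[q qC ->]].
    exists (rev p); last by case: p {pup pC}.
    rewrite inE cl //= /up /=; move: pup; rewrite /up -leqNgt leq_eqVlt => /orP[|//].
    rewrite (inj_eq val_inj) (inj_eq enum_rank_inj) => /eqP E.
    by have := CD _ pC; rewrite inE E eI.
  move: qC; rewrite inE => /andP[qC qup]; split; last exact: cl.
  by rewrite -leqNgt ltnW.
by rewrite addnn odd_double.
Qed.

(* A triangle would bound a region with three boundary darts, although a union of
   4-faces has an even boundary. *)
Lemma quad_trifree u v w : e u v -> e v w -> ~~ e u w.
Proof.
move=> uv vw; apply/negP=> uw; pose T := [set u; v; w].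
have ne a b : e a b -> a != b by apply: contraTneq => ->; rewrite eI.
have cT : #|T| = 3.
  by rewrite cards3 //= !inE negb_or !ne.
have T0 : T != set0 by rewrite -card_gt0 cT.
have nT : 6 <= narcs e T T.
  have deg a : a \in T -> 2 <= #|nb e T a|.
    move=> aT; suff : T :\ a \subset nb e T a.
      by move/subset_leq_card; have := cardsD1 a T; rewrite aT cT; lia.
    apply/subsetP=> b; rewrite in_setD1 in_nb => /andP[ba bT]; rewrite bT /=.
    move: aT bT ba; rewrite !inE -!orbA.
    by move=> /or3P[]/eqP-> /or3P[]/eqP->; rewrite ?eqxx // => _; rewrite // eC.
  have : \sum_(a in T) 2 <= narcs e T T by apply: leq_sum => a; exact: deg.
  by rewrite sum_nat_const cT.
have F2 : 1 < #|regions T| by have := euler_sub T0; rewrite cT; move: nT; lia.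
have pD : (u, v) \in D by rewrite dartE.
have [a [b [c [d [ab bc cd un /and3P[db dc _]]]]]] := region_boundary pD F2.
set C := region T (u, v) in ab bc cd.
have bT p : p \in boundary C -> inside T p.
  by move/(subsetP (boundary_inside T pD)); rewrite inE.
have /andP[aT bT'] := bT _ ab; have /andP[_ cT'] := bT _ bc; have /andP[_ dT] := bT _ cd.
have TE : T = [set a; b; c].
  apply/esym/eqP; rewrite eqEcard cT; apply/andP; split.
    by apply/subsetP=> x; rewrite !inE -orbA => /or3P[]/eqP->; move: aT bT' cT'; rewrite !inE.
  by rewrite cards3.
(* The boundary walk stays in [T] and has used up its three vertices, so it closes. *)
have da : d = a.
  by move: dT; rewrite TE !inE (negbTE db) (negbTE dc) !orbF => /eqP.
rewrite da in cd.
have CD : C \subset D by exact: region_sub.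
(* The other darts inside [T] are reverses of these three, so they are not on the boundary. *)
have bE : boundary C = [set (a, b); (b, c); (c, a)].
  apply/setP=> -[x y]; apply/idP/idP => [xy|]; last first.
    by case/setUP=> [/set2P[]|/set1P] ->.
  have /andP[/= xT yT] := bT _ xy.
  have : x != y.
    move: xy; rewrite inE => /andP[/(subsetP CD)]; rewrite dartE => exy _; exact: ne.
  have nrev s t : (s, t) \in boundary C -> (t, s) \notin boundary C.
    by rewrite !inE negb_and /= => /andP[_ ->].
  move: xT yT; rewrite TE !inE -!orbA.
  move=> /or3P[]/eqP Ex /or3P[]/eqP Ey; rewrite Ex Ey in xy *; rewrite ?eqxx ?orbT // => _.
  - by case/negP: (nrev _ _ cd).
  - by case/negP: (nrev _ _ ab).
  - by case/negP: (nrev _ _ bc).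
have c3 : #|boundary C| = 3.
  move: un; rewrite bE /= !inE negb_or andbT => /andP[/andP[h1 h2] h3].
  by rewrite cards3 //= !inE !xpair_eqE (negbTE h1) (negbTE h2) (negbTE h3).
have := card_phi_closed CD (fun q => @region_phi T _ q pD).
have : ~~ odd #|C :\: boundary C|.
  apply: even_rev_closed; first exact: subset_trans (subsetDl _ _) CD.
  move=> q; rewrite !in_setD !in_boundary (_ : rev (rev q) = q); last by case: q.
  by case: (q \in C); case: (rev q \in C).
have bC : boundary C \subset C by apply/subsetP=> q; rewrite inE => /andP[].
rewrite cardsD (setIidPr bC) c3 -/C => h1 h2; move: h1.
have : 3 <= #|C| by rewrite -c3 subset_leq_card.
rewrite h2; clear; lia.
Qed.

Lemma narcs_inside T : narcs e T T = \sum_(p in D) inside T p.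
Proof.
rewrite narcsE pair_big_dep /= big_mkcond /= [RHS]big_mkcond /=.
by apply: eq_bigr => -[u v] _; rewrite dartE /inside /=; do 2!case: (_ \in T); case: (e u v).
Qed.

(** With at least two regions, each has four boundary darts, as without triangles the walk cannot
    close after three; so [4 * #|regions T| <= narcs e T T], to be combined with Euler's inequality.
    A single region leaves at most [2 * #|T| - 2] arcs. *)
Lemma quad_sparse T : 3 <= #|T| -> narcs e T T + 8 <= 4 * #|T|.
Proof.
move=> T3; have T0 : T != set0 by rewrite -card_gt0 (leq_trans _ T3).
have eu := euler_sub T0.
have [F2|F1] := ltnP 1 #|regions T|; last by lia.
suff : #|regions T| * 4 <= narcs e T T by lia.
rewrite narcs_inside (sum_regions T) -sum_nat_const; apply: leq_sum => _ /imsetP[p pD ->].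
have [u [v [w [z [uv vw wz un /and3P[zv zw ewz]]]]]] := region_boundary pD F2.
have CD : region T p \subset D by exact: region_sub.
have [y zy] := boundary_next CD (fun q => @region_phi T p q pD) wz.
have edge a b : (a, b) \in boundary (region T p) -> e a b.
  by rewrite inE => /andP[/(subsetP CD)]; rewrite dartE.
have zu : z != u.
  by apply: contraTneq ewz => ->; rewrite eC; apply: quad_trifree (edge _ _ uv) (edge _ _ vw).
pose s := [:: (u, v); (v, w); (w, z); (z, y)].
have us : uniq s.
  rewrite -(map_inj_uniq (f := id)) // /s /= !inE !xpair_eqE.
  move: un; rewrite /= !inE negb_or andbT => /andP[/andP[h1 h2] h3].
  rewrite (negbTE h1) (negbTE h2) (negbTE h3) (eq_sym u z) (negbTE zu).
  by rewrite (eq_sym v z) (negbTE zv) (eq_sym w z) (negbTE zw).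
have -> : 4 = #|[set x in s]| by rewrite cardsE (card_uniqP us).
rewrite -sum1_card big_mkcond /= [X in _ <= X]big_mkcond /=; apply: leq_sum => q _.
case: ifP => //; rewrite inE => qs.
have qb : q \in boundary (region T p).
  by move: qs; rewrite /s !(in_cons, in_nil) orbF => /or4P[]/eqP->.
have := subsetP (boundary_inside T pD) _ qb; rewrite inE => ->.
by move: qb; rewrite inE => /andP[->].
Qed.

End Planar.

(** * Comparing ball distances with graph distance and the Wiener index *)

Section Link.

Variables (V : finType) (e : rel V).

Lemma ball_walk k (u v : V) : v \in ball e setT [set u] k ->
  exists2 j, j <= k & walk_of_length e j u v.
Proof.
elim: k v => [|k IH] v /=.
  by rewrite inE => /eqP->; exists 0 => //; apply/existsP; exists [tuple]; rewrite /= eqxx.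
rewrite inE => /orP[/IH[j jk h]|/nbhdP[_ [w /IH[j jk /existsP[t /andP[pt /eqP lt]]] wv]]].
  by exists j => //; exact: leqW.
exists j.+1 => //; apply/existsP; exists [tuple of rcons t v].
by rewrite /= rcons_path pt lt wv last_rcons eqxx.
Qed.

Lemma dist_le_sdist (u v : V) : dist e u v <= sdist e setT [set u] v.
Proof.
rewrite /dist; have [lt|ge] := ltnP (sdist e setT [set u] v) #|V|; last first.
  by apply: leq_trans ge; rewrite -[X in _ <= X](size_iota 0) find_size.
have [j jk hj] := ball_walk (sdist_ball lt); apply: leq_trans jk.
rewrite leqNgt; apply/negP=> lj; have := before_find 0 lj.
by rewrite nth_iota ?hj // (leq_trans lj) // -[X in _ <= X](size_iota 0) find_size.
Qed.

(** The pairs with [~~ (i < j)] comprise the mirror images of those with [i < j] and the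
    diagonal. *)
Lemma wiener_le : symmetric e -> 2 * wiener e <= wsum e setT.
Proof.
move=> eC; pose d (i j : 'I_#|V|) := sdist e setT [set enum_val i] (enum_val j).
have dC i j : d i j = d j i by apply: sdistC; rewrite ?inE.
have W : wiener e <= \sum_(i < #|V|) \sum_(j < #|V| | i < j) d i j.
  by apply: leq_sum => i _; apply: leq_sum => j _; exact: dist_le_sdist.
have -> : wsum e setT = \sum_(i < #|V|) \sum_(j < #|V|) d i j.
  rewrite /wsum (reindex (@enum_val V predT)) /=; last exact/onW_bij/enum_val_bij.
  rewrite big_mkcond /=; under eq_bigr do rewrite inE.
  apply: eq_bigr => i _.
  rewrite /transm (reindex (@enum_val V predT)) /=; last exact/onW_bij/enum_val_bij.
  by apply: eq_bigl => j; rewrite inE.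
have -> : \sum_(i < #|V|) \sum_(j < #|V|) d i j =
   \sum_(i < #|V|) \sum_(j < #|V| | i < j) d i j + \sum_(i < #|V|) \sum_(j < #|V| | ~~ (i < j)) d i j.
  by rewrite -big_split /=; apply: eq_bigr => i _; rewrite (bigID (fun j : 'I_#|V| => i < j)).
have : \sum_(i < #|V|) \sum_(j < #|V| | i < j) d i j <= \sum_(i < #|V|) \sum_(j < #|V| | ~~ (i < j)) d i j.
  rewrite (exchange_big_dep predT) //=; apply: leq_sum => j _.
  under eq_bigr do rewrite dC.
  rewrite big_mkcond /= [X in _ <= X]big_mkcond /=; apply: leq_sum => i _.
  by case: ltngtP.
lia.
Qed.

End Link.

Import Order.TTheory GRing.Theory Num.Theory.
Local Open Scope ring_scope.

Theorem theorem2 (V : finType) (e : rel V) (rot : V -> V -> V) :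
  quadrangulation e rot -> (4 <= #|V|)%N ->
  let n : rat := (#|V|)%:R in
  (wiener e)%:R <=
    (if odd #|V|
     then n ^+ 3 / 12%:R + 11%:R / 12%:R * n - 1
     else n ^+ 3 / 12%:R + 7%:R / 6%:R * n - 2%:R).
Proof.
move=> [[eC eI] conn rotS sph quad] V4; cbv zeta.
have sparse := quad_sparse eC eI conn rotS sph quad.
have trifree := quad_trifree eC eI conn rotS sph quad.
(* All darts lie inside the full vertex set, and with 4-faces Euler's formula fixes their number. *)
have tV : tight e setT.
  rewrite /tight cardsT -(card_darts eC rotS sph quad) narcs_inside /inside; congr (_ + _)%N.
  by rewrite -sum1_card; apply: eq_bigr => p _; rewrite !inE.
have := wiener_bound_tight eC eI sparse trifree tV; rewrite cardsT => /(_ (ltnW V4)).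
have := wiener_le eC; move: (wsum _ _) (wiener e) => w W hW.
rewrite /wiener_bound; case: odd => hw.
- have : 12%:R * W%:R + 12%:R <= (#|V|)%:R ^+ 3 + 11%:R * (#|V|)%:R :> rat.
    by rewrite -natrX -!natrM -!natrD ler_nat; lia.
  by lra.
have : 12%:R * W%:R + 24%:R <= (#|V|)%:R ^+ 3 + 14%:R * (#|V|)%:R :> rat.
  by rewrite -natrX -!natrM -!natrD ler_nat; lia.
by lra.
Qed.
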